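(* The Kantorovich monad $(P,\delta,E)$ on $\mathsf{CMet}$ is a symmetric bimonoidal monad, with monoidal structure given by the product joint $\nabla$ (and trivial unit $1\cong P(1)$), and opmonoidal structure given by the marginals $\Delta$ (and trivial counit $P(1)\cong 1$).
   Context: A map between metric spaces is short if it is $1$-Lipschitz. $\mathsf{CMet}$ is the category of complete metric spaces and short maps, with the symmetric monoidal structure in which $X\otimes Y$ is the set $X\times Y$ with metric $d((x,y),(x',y')):=d(x,x')+d(y,y')$, the unit is the one-point space $1$, and associators, unitors and symmetry are the evident ones. A Radon probability measure $p$ on a complete metric space $X$ has finite first moment if $\int_X f\,dp<\infty$ for every short $f:X\to\mathbb{R}$; such measures are uniquely determined by their integrals against short maps. $PX$ is the set of these measures with the metric $d(p,q):=\sup_f|\int_X f\,dp-\int_X f\,dq|$, the supremum over short maps $f:X\to\mathbb{R}$; $PX$ is again a complete metric space. For $f:X\to Y$ short, $Pf:PX\to PY$ is push-forward of measures $f_*$. This is a functor $P:\mathsf{CMet}\to\mathsf{CMet}$ with $P(1)\cong 1$. The Kantorovich monad is $P$ with unit $\delta:X\to PX$, $x\mapsto\delta_x$ (Dirac measure), and multiplication $E:PPX\to PX$ given by $\int_X f\,d(E\mu):=\int_{PX}\left(\int_X f\,dp\right)d\mu(p)$ for short $f$. The map $\nabla_{X,Y}:PX\otimes PY\to P(X\otimes Y)$ sends $(p,q)$ to the product measure $p\otimes_\nabla q$, defined by $\int f\,d(p\otimes_\nabla q):=\int f(x,y)\,dp(x)\,dq(y)$ for short $f:X\otimes Y\to\mathbb{R}$.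 The map $\Delta_{X,Y}:P(X\otimes Y)\to PX\otimes PY$ sends $r$ to its pair of marginals $(r_X,r_Y)$, where $\int_X f\,dr_X:=\int_{X\otimes Y}f(x)\,dr(x,y)$ for short $f:X\to\mathbb{R}$, and similarly for $r_Y$. A symmetric bimonoidal monad on a symmetric monoidal category is a monad $(P,\delta,E)$ with a lax monoidal structure $(\eta:1\to P(1),\nabla_{X,Y}:PX\otimes PY\to P(X\otimes Y))$ and an oplax monoidal structure $(\epsilon:P(1)\to 1,\Delta_{X,Y}:P(X\otimes Y)\to PX\otimes PY)$ on $P$, both commuting with the symmetry $\beta$ (i.e. $P(\beta_{X,Y})\circ\nabla_{X,Y}=\nabla_{Y,X}\circ\beta_{PX,PY}$ and $\Delta_{Y,X}\circ P(\beta_{X,Y})=\beta_{PX,PY}\circ\Delta_{X,Y}$), such that: (i) for all $W,X,Y,Z$, $$\Delta_{W\otimes Y,X\otimes Z}\circ P(\mathrm{id}_W\otimes \beta_{X,Y}\otimes \mathrm{id}_Z)\circ\nabla_{W\otimes X,Y\otimes Z}=(\nabla_{W,Y}\otimes\nabla_{X,Z})\circ(\mathrm{id}\otimes\beta_{PX,PY}\otimes\mathrm{id})\circ(\Delta_{W,X}\otimes\Delta_{Y,Z}),$$ associators suppressed; (ii) $\epsilon\circ\eta=\mathrm{id}_1$; the composite $1\xrightarrow{\eta}P(1)\cong P(1\otimes 1)\xrightarrow{\Delta_{1,1}}P(1)\otimes P(1)$ equals $1\cong 1\otimes 1\xrightarrow{\eta\otimes\eta}P(1)\otimes P(1)$;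 and $P(1)\otimes P(1)\xrightarrow{\nabla_{1,1}}P(1\otimes 1)\cong P(1)\xrightarrow{\epsilon}1$ equals $P(1)\otimes P(1)\xrightarrow{\epsilon\otimes\epsilon}1\otimes 1\cong 1$; (iii) $\delta:\mathrm{id}\Rightarrow P$ and $E:PP\Rightarrow P$ are both lax and oplax monoidal natural transformations, where $PP$ carries the composite structures with multiplication $P(\nabla_{X,Y})\circ\nabla_{PX,PY}$ and comultiplication $\Delta_{PX,PY}\circ P(\Delta_{X,Y})$. *)

(* Defs.v *)
From HB Require Import structures.
From mathcomp Require Import all_boot all_order all_algebra.
From mathcomp Require Import all_classical all_reals all_analysis.

Set Implicit Arguments.
Unset Strict Implicit.
Unset Printing Implicit Defensive.

Import Order.TTheory GRing.Theory Num.Theory.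
Import numFieldTopology.Exports numFieldNormedType.Exports.

Local Open Scope classical_set_scope.
Local Open Scope ring_scope.

(** * Symmetric monoidal categories *)

Record category := Category {
  obj :> Type;
  hom : obj -> obj -> Type;
  idc : forall X, hom X X;
  compc : forall X Y Z, hom Y Z -> hom X Y -> hom X Z;
  comp1c : forall X Y (f : hom X Y), compc (idc Y) f = f;
  compc1 : forall X Y (f : hom X Y), compc f (idc X) = f;
  compA : forall W X Y Z (h : hom Y Z) (g : hom X Y) (f : hom W X),
    compc h (compc g f) = compc (compc h g) f }.

Arguments hom {c} X Y.
Arguments idc {c} X.
Arguments compc {c X Y Z} g f.
Notation "g '\;c' f" := (compc g f)
  (at level 50, left associativity, format "g  \;c  f").

Record symmetric_monoidal_category := SymmetricMonoidalCategory {
  smcat :> category;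
  tens : smcat -> smcat -> smcat;
  tensh : forall W X Y Z : smcat,
    hom W Y -> hom X Z -> hom (tens W X) (tens Y Z);
  tunit : smcat;
  assoc : forall X Y Z, hom (tens (tens X Y) Z) (tens X (tens Y Z));
  associ : forall X Y Z, hom (tens X (tens Y Z)) (tens (tens X Y) Z);
  lunit : forall X, hom (tens tunit X) X;
  luniti : forall X, hom X (tens tunit X);
  runit : forall X, hom (tens X tunit) X;
  runiti : forall X, hom X (tens X tunit);
  braid : forall X Y, hom (tens X Y) (tens Y X);
  tensh1 : forall X Y, tensh (idc X) (idc Y) = idc (tens X Y);
  tenshM : forall X X' X'' Y Y' Y'' (g : hom X' X'') (f : hom X X')
      (k : hom Y' Y'') (h : hom Y Y'),
    tensh (g \;c f) (k \;c h) = tensh g k \;c tensh f h;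
  assocK : forall X Y Z, associ X Y Z \;c assoc X Y Z = idc _;
  associK : forall X Y Z, assoc X Y Z \;c associ X Y Z = idc _;
  lunitK : forall X, luniti X \;c lunit X = idc _;
  lunitiK : forall X, lunit X \;c luniti X = idc _;
  runitK : forall X, runiti X \;c runit X = idc _;
  runitiK : forall X, runit X \;c runiti X = idc _;
  assoc_natural : forall X X' Y Y' Z Z' (f : hom X X') (g : hom Y Y')
      (h : hom Z Z'),
    assoc X' Y' Z' \;c tensh (tensh f g) h
    = tensh f (tensh g h) \;c assoc X Y Z;
  lunit_natural : forall X Y (f : hom X Y),
    lunit Y \;c tensh (idc tunit) f = f \;c lunit X;
  runit_natural : forall X Y (f : hom X Y),
    runit Y \;c tensh f (idc tunit) = f \;c runit X;
  braid_natural : forall X X' Y Y' (f : hom X X') (g : hom Y Y'),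
    braid X' Y' \;c tensh f g = tensh g f \;c braid X Y;
  triangle : forall X Y,
    tensh (idc X) (lunit Y) \;c assoc X tunit Y = tensh (runit X) (idc Y);
  pentagon : forall W X Y Z,
    assoc W X (tens Y Z) \;c assoc (tens W X) Y Z
    = tensh (idc W) (assoc X Y Z) \;c assoc W (tens X Y) Z
        \;c tensh (assoc W X Y) (idc Z);
  hexagon : forall X Y Z,
    assoc Y Z X \;c braid X (tens Y Z) \;c assoc X Y Z
    = tensh (idc Y) (braid X Z) \;c assoc Y X Z \;c tensh (braid X Y) (idc Z);
  braidK : forall X Y, braid Y X \;c braid X Y = idc _ }.

Arguments tens {s} X Y.
Arguments tensh {s W X Y Z} f g.
Arguments tunit {s}.
Arguments assoc {s} X Y Z.
Arguments associ {s} X Y Z.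
Arguments lunit {s} X.
Arguments luniti {s} X.
Arguments runit {s} X.
Arguments runiti {s} X.
Arguments braid {s} X Y.
Notation "X '*t' Y" := (tens X Y)
  (at level 40, left associativity, format "X  *t  Y").
Notation "f '*h' g" := (tensh f g)
  (at level 40, left associativity, format "f  *h  g").

(** * Symmetric bimonoidal monads

   Structure maps ([endomap], [transformation], [lax], [oplax]) are kept
   separate from the equations they have to satisfy, so that a theorem can
   speak about given maps. *)

Section bimonoidal.
Variable C : symmetric_monoidal_category.

Record endomap := Endomap {
  fobj :> C -> C;
  fmap : forall X Y, hom X Y -> hom (fobj X) (fobj Y) }.

Definition endo_id : endomap := @Endomap (fun X => X) (fun _ _ f => f).
Definition endo_comp (F G : endomap) : endomap :=
  @Endomap (fun X => F (G X)) (fun _ _ f => fmap F (fmap G f)).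

Record is_functor (F : endomap) : Prop := IsFunctor {
  fmap1 : forall X, fmap F (idc X) = idc (F X);
  fmapM : forall X Y Z (g : hom Y Z) (f : hom X Y),
    fmap F (g \;c f) = fmap F g \;c fmap F f }.

Definition transformation (F G : endomap) := forall X, hom (F X) (G X).

Definition is_natural (F G : endomap) (t : transformation F G) : Prop :=
  forall X Y (f : hom X Y), t Y \;c fmap F f = fmap G f \;c t X.

Record is_monad (P : endomap) (d : transformation endo_id P)
    (e : transformation (endo_comp P P) P) : Prop := IsMonad {
  monad_functor : is_functor P;
  monad_unit_natural : is_natural d;
  monad_mult_natural : is_natural e;
  monad_left_unit : forall X, e X \;c d (P X) = idc (P X);
  monad_right_unit : forall X, e X \;c fmap P (d X) = idc (P X);
  monad_assoc : forall X, e X \;c e (P X) = e X \;c fmap P (e X) }.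

Record lax (F : endomap) := Lax {
  lax_unit : hom tunit (F tunit);
  lax_mult : forall X Y, hom (F X *t F Y) (F (X *t Y)) }.

Record oplax (F : endomap) := Oplax {
  oplax_unit : hom (F tunit) tunit;
  oplax_mult : forall X Y, hom (F (X *t Y)) (F X *t F Y) }.

Record is_lax_monoidal (F : endomap) (L : lax F) : Prop := IsLaxMonoidal {
  lax_natural : forall X X' Y Y' (f : hom X X') (g : hom Y Y'),
    lax_mult L X' Y' \;c (fmap F f *h fmap F g)
    = fmap F (f *h g) \;c lax_mult L X Y;
  lax_assoc : forall X Y Z,
    fmap F (assoc X Y Z) \;c lax_mult L (X *t Y) Z
      \;c (lax_mult L X Y *h idc (F Z))
    = lax_mult L X (Y *t Z) \;c (idc (F X) *h lax_mult L Y Z)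
      \;c assoc (F X) (F Y) (F Z);
  lax_lunit : forall X,
    fmap F (lunit X) \;c lax_mult L tunit X \;c (lax_unit L *h idc (F X))
    = lunit (F X);
  lax_runit : forall X,
    fmap F (runit X) \;c lax_mult L X tunit \;c (idc (F X) *h lax_unit L)
    = runit (F X) }.

Record is_oplax_monoidal (F : endomap) (M : oplax F) : Prop :=
  IsOplaxMonoidal {
  oplax_natural : forall X X' Y Y' (f : hom X X') (g : hom Y Y'),
    oplax_mult M X' Y' \;c fmap F (f *h g)
    = (fmap F f *h fmap F g) \;c oplax_mult M X Y;
  oplax_assoc : forall X Y Z,
    assoc (F X) (F Y) (F Z) \;c (oplax_mult M X Y *h idc (F Z))
      \;c oplax_mult M (X *t Y) Z
    = (idc (F X) *h oplax_mult M Y Z) \;c oplax_mult M X (Y *t Z)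
      \;c fmap F (assoc X Y Z);
  oplax_lunit : forall X,
    lunit (F X) \;c (oplax_unit M *h idc (F X)) \;c oplax_mult M tunit X
    = fmap F (lunit X);
  oplax_runit : forall X,
    runit (F X) \;c (idc (F X) *h oplax_unit M) \;c oplax_mult M X tunit
    = fmap F (runit X) }.

Definition lax_id : lax endo_id :=
  @Lax endo_id (idc tunit) (fun X Y => idc (X *t Y)).
Definition oplax_id : oplax endo_id :=
  @Oplax endo_id (idc tunit) (fun X Y => idc (X *t Y)).

Definition lax_comp (F G : endomap) (K : lax F) (L : lax G) :
    lax (endo_comp F G) :=
  @Lax (endo_comp F G)
    (fmap F (lax_unit L) \;c lax_unit K)
    (fun X Y => fmap F (lax_mult L X Y) \;c lax_mult K (G X) (G Y)).
Definition oplax_comp (F G : endomap) (K : oplax F) (L : oplax G) :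
    oplax (endo_comp F G) :=
  @Oplax (endo_comp F G)
    (oplax_unit K \;c fmap F (oplax_unit L))
    (fun X Y => oplax_mult K (G X) (G Y) \;c fmap F (oplax_mult L X Y)).

Record is_lax_transformation (F G : endomap) (K : lax F) (L : lax G)
    (t : transformation F G) : Prop := IsLaxTransformation {
  lax_transf_unit : t tunit \;c lax_unit K = lax_unit L;
  lax_transf_mult : forall X Y,
    t (X *t Y) \;c lax_mult K X Y = lax_mult L X Y \;c (t X *h t Y) }.

Record is_oplax_transformation (F G : endomap) (K : oplax F) (L : oplax G)
    (t : transformation F G) : Prop := IsOplaxTransformation {
  oplax_transf_unit : oplax_unit L \;c t tunit = oplax_unit K;
  oplax_transf_mult : forall X Y,
    oplax_mult L X Y \;c t (X *t Y) = (t X *h t Y) \;c oplax_mult K X Y }.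

(* id_W * braid X Y * id_Z, with the associators made explicit *)
Definition interchange (W X Y Z : C) :
    hom ((W *t X) *t (Y *t Z)) ((W *t Y) *t (X *t Z)) :=
  associ W Y (X *t Z)
    \;c (idc W *h (assoc Y X Z \;c (braid X Y *h idc Z) \;c associ X Y Z))
    \;c assoc W X (Y *t Z).

Record is_symmetric_bimonoidal_monad (P : endomap)
    (d : transformation endo_id P) (e : transformation (endo_comp P P) P)
    (L : lax P) (M : oplax P) : Prop := IsSymmetricBimonoidalMonad {
  sbm_monad : is_monad d e;
  sbm_lax : is_lax_monoidal L;
  sbm_oplax : is_oplax_monoidal M;
  sbm_lax_symmetric : forall X Y,
    fmap P (braid X Y) \;c lax_mult L X Y
    = lax_mult L Y X \;c braid (P X) (P Y);
  sbm_oplax_symmetric : forall X Y,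
    oplax_mult M Y X \;c fmap P (braid X Y)
    = braid (P X) (P Y) \;c oplax_mult M X Y;
  sbm_bimonoidality : forall W X Y Z,
    oplax_mult M (W *t Y) (X *t Z) \;c fmap P (interchange W X Y Z)
      \;c lax_mult L (W *t X) (Y *t Z)
    = (lax_mult L W Y *h lax_mult L X Z)
      \;c interchange (P W) (P X) (P Y) (P Z)
      \;c (oplax_mult M W X *h oplax_mult M Y Z);
  sbm_unit_counit : oplax_unit M \;c lax_unit L = idc tunit;
  sbm_unit_comult :
    oplax_mult M tunit tunit \;c fmap P (luniti tunit) \;c lax_unit L
    = (lax_unit L *h lax_unit L) \;c luniti tunit;
  sbm_mult_counit :
    oplax_unit M \;c fmap P (lunit tunit) \;c lax_mult L tunit tunit
    = lunit tunit \;c (oplax_unit M *h oplax_unit M);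
  sbm_monad_unit_lax : is_lax_transformation lax_id L d;
  sbm_monad_unit_oplax : is_oplax_transformation oplax_id M d;
  sbm_monad_mult_lax : is_lax_transformation (lax_comp L L) L e;
  sbm_monad_mult_oplax : is_oplax_transformation (oplax_comp M M) M e }.

End bimonoidal.

(** * Complete metric spaces and short maps *)

(* The library's [completeType] is pointed, whereas a complete metric space may
   be empty; hence the unpointed form of its axiom [cauchy_cvg]. *)
Definition complete_space (T : uniformType) : Prop :=
  forall F : set_system T, ProperFilter F -> cauchy F -> exists l : T, F --> l.

Record is_metric (R : realType) (T : Type) (d : T -> T -> R) : Prop :=
  IsMetric {
  is_metric_xx : forall x, d x x = 0;
  is_metric_eq : forall x y, d x y = 0 -> x = y;
  is_metric_sym : forall x y, d x y = d y x;
  is_metric_triangle : forall y x z, d x z <= d x y + d y z }.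

Definition metrized (R : realType) (T : Type) (d : T -> T -> R)
  (H : is_metric d) : Type := T.

Section metrized.
Variables (R : realType) (T : Type) (d : T -> T -> R) (H : is_metric d).
HB.instance Definition _ := gen_eqMixin (metrized H).
HB.instance Definition _ := gen_choiceMixin (metrized H).
HB.instance Definition _ := @isMetric.Build R (metrized H) d (is_metric_xx H)
  (is_metric_eq H) (is_metric_sym H) (is_metric_triangle H).
End metrized.

Record is_complete_metric (R : realType) (T : Type) (d : T -> T -> R) : Prop :=
  IsCompleteMetric {
  complete_metric_is_metric : is_metric d;
  complete_metric_complete : complete_space (metrized complete_metric_is_metric)
  }.

Record cmet (R : realType) := CMetSpace {
  cmet_sort :> metricType R;
  cmet_complete : complete_space cmet_sort }.

Definition cmet_of (R : realType) (T : Type) (d : T -> T -> R)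
    (H : is_complete_metric d) : cmet R :=
  @CMetSpace R (metrized (complete_metric_is_metric H))
    (@complete_metric_complete R T d H).

Definition short (R : realType) (X Y : metricType R) (f : X -> Y) : Prop :=
  forall x x', mdist (f x) (f x') <= mdist x x'.

Record short_map (R : realType) (X Y : metricType R) := ShortMap {
  short_fun :> X -> Y;
  short_funP : short short_fun }.

Section short_maps.
Variable R : realType.
Implicit Types X Y Z : metricType R.

Lemma short_map_eq X Y (f g : short_map X Y) : f =1 g -> f = g.
Proof.
case: f g => [f fs] [g gs] /= /funext fg; rewrite -fg in gs *.
by congr ShortMap; exact: Prop_irrelevance.
Qed.

Definition short_id X : short_map X X :=
  @ShortMap R X X (fun x => x) (fun x x' => lexx _).

Lemma short_comp_subproof X Y Z (g : short_map Y Z) (f : short_map X Y) :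
  short (fun x => g (f x)).
Proof. by move=> x x'; exact: le_trans (short_funP g _ _) (short_funP f _ _). Qed.

Definition short_comp X Y Z (g : short_map Y Z) (f : short_map X Y) :
  short_map X Z := ShortMap (short_comp_subproof g f).

Lemma short_comp1c X Y (f : short_map X Y) : short_comp (short_id Y) f = f.
Proof. exact: short_map_eq. Qed.

Lemma short_compc1 X Y (f : short_map X Y) : short_comp f (short_id X) = f.
Proof. exact: short_map_eq. Qed.

Lemma short_compA W X Y Z (h : short_map Y Z) (g : short_map X Y)
    (f : short_map W X) :
  short_comp h (short_comp g f) = short_comp (short_comp h g) f.
Proof. exact: short_map_eq. Qed.

Definition cmet_category : category :=
  @Category (cmet R) (fun X Y : cmet R => short_map X Y)
    (fun X : cmet R => short_id X)
    (fun X Y Z : cmet R => @short_comp X Y Z)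
    (fun X Y : cmet R => @short_comp1c X Y)
    (fun X Y : cmet R => @short_compc1 X Y)
    (fun W X Y Z : cmet R => @short_compA W X Y Z).

End short_maps.

Section tensor.
Variable R : realType.

Section product.
Variables X Y : cmet R.

Definition sum_dist (a b : X * Y) : R := mdist a.1 b.1 + mdist a.2 b.2.

Lemma sum_dist_is_metric : is_metric sum_dist.
Proof.
split.
- by move=> x; rewrite /sum_dist !mdistxx addr0.
- move=> [x y] [x' y'] /eqP; rewrite /sum_dist /= paddr_eq0 ?mdist_ge0//.
  by case/andP=> /eqP/mdist_positivity -> /eqP/mdist_positivity ->.
- by move=> x y; rewrite /sum_dist [mdist x.1 _]metric_sym [mdist x.2 _]metric_sym.
- by move=> y x z; rewrite /sum_dist addrACA lerD// metric_triangle.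
Qed.

Let T : metricType R := metrized sum_dist_is_metric.

Lemma cauchy_short (Z : metricType R) (g : T -> Z) (F : set_system T) :
  short g -> ProperFilter F -> cauchy F -> cauchy (g @ F).
Proof.
move=> gs FF /cauchy_ballP cF; apply/cauchy_ballP => e e0.
have [[A B]/= [FA FB] AB] := cF _ e0.
exists (g @` A, g @` B) => /=.
  by split; rewrite /fmap /nbhs /=;
    [apply: filterS FA|apply: filterS FB] => t At; exists t.
move=> [_ _] [/= [a Aa <-] [b Bb <-]].
have := AB (a, b) (conj Aa Bb); rewrite /= !ballEmdist /=.
by apply: le_lt_trans; exact: gs.
Qed.

Lemma sum_dist_complete : complete_space T.
Proof.
move=> F FF cF.
have s1 : short (fun t : T => (t : X * Y).1).
  by move=> t t'; rewrite [leRHS]/mdist /= lerDl mdist_ge0.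
have s2 : short (fun t : T => (t : X * Y).2).
  by move=> t t'; rewrite [leRHS]/mdist /= lerDr mdist_ge0.
have [x Fx] := cmet_complete _ (cauchy_short s1 FF cF).
have [y Fy] := cmet_complete _ (cauchy_short s2 FF cF).
exists ((x, y) : T); apply/metricType_numDomainType.fcvgrPdist_lt => e e0.
have e2 : 0 < e / 2 by rewrite divr_gt0.
move/metricType_numDomainType.cvgrPdist_lt : Fx => /(_ _ e2) Fx.
move/metricType_numDomainType.cvgrPdist_lt : Fy => /(_ _ e2) Fy.
near=> t; rewrite [ltLHS]/mdist /= /sum_dist [ltRHS]splitr ltrD//.
  by near: t.
by near: t.
Unshelve. all: by end_near. Qed.

Lemma sum_dist_is_complete_metric : is_complete_metric sum_dist.
Proof. exists sum_dist_is_metric; exact: sum_dist_complete. Qed.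

Definition tensor : cmet R := cmet_of sum_dist_is_complete_metric.

Lemma tensor_distE (a b : tensor) :
  mdist a b = mdist (a : X * Y).1 (b : X * Y).1
              + mdist (a : X * Y).2 (b : X * Y).2.
Proof. by []. Qed.

End product.

Definition point_dist (x y : unit) : R := 0.

Lemma point_dist_is_complete_metric : is_complete_metric point_dist.
Proof.
unshelve eexists.
  by split=> //; [move=> [] []|move=> *; rewrite /point_dist addr0].
move=> F FF cF; exists tt; apply/metricType_numDomainType.fcvgrPdist_lt => e e0.
by near=> t; rewrite [ltLHS]/mdist.
Unshelve. all: by end_near. Qed.

Definition one_point : cmet R := cmet_of point_dist_is_complete_metric.

Implicit Types W X Y Z : cmet R.

Lemma tensor_map_short W X Y Z (f : short_map W Y) (g : short_map X Z) :
  short (fun a : tensor W X => (f (a : W * X).1, g (a : W * X).2) : tensor Y Z).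
Proof. by move=> a b; rewrite !tensor_distE /= lerD// short_funP. Qed.
Definition tensor_map W X Y Z (f : short_map W Y) (g : short_map X Z) :
  short_map (tensor W X) (tensor Y Z) := ShortMap (tensor_map_short f g).

Lemma tensor_assoc_short X Y Z :
  short (fun a : tensor (tensor X Y) Z =>
    let: ((x, y), z) := a : X * Y * Z in (x, (y, z)) : tensor X (tensor Y Z)).
Proof. by move=> [[x y] z] [[x' y'] z']; rewrite !tensor_distE /= addrA. Qed.
Definition tensor_assoc X Y Z :
  short_map (tensor (tensor X Y) Z) (tensor X (tensor Y Z)) :=
  ShortMap (@tensor_assoc_short X Y Z).

Lemma tensor_associ_short X Y Z :
  short (fun a : tensor X (tensor Y Z) =>
    let: (x, (y, z)) := a : X * (Y * Z) in ((x, y), z) : tensor (tensor X Y) Z).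
Proof. by move=> [x [y z]] [x' [y' z']]; rewrite !tensor_distE /= addrA. Qed.
Definition tensor_associ X Y Z :
  short_map (tensor X (tensor Y Z)) (tensor (tensor X Y) Z) :=
  ShortMap (@tensor_associ_short X Y Z).

Lemma tensor_lunit_short X :
  short (fun a : tensor one_point X => (a : unit * X).2).
Proof. by move=> a b; rewrite tensor_distE lerDr mdist_ge0. Qed.
Definition tensor_lunit X : short_map (tensor one_point X) X :=
  ShortMap (@tensor_lunit_short X).

Lemma tensor_luniti_short X :
  short (fun x : X => (tt, x) : tensor one_point X).
Proof. by move=> x y; rewrite tensor_distE /= mdistxx add0r. Qed.
Definition tensor_luniti X : short_map X (tensor one_point X) :=
  ShortMap (@tensor_luniti_short X).

Lemma tensor_runit_short X :
  short (fun a : tensor X one_point => (a : X * unit).1).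
Proof. by move=> a b; rewrite tensor_distE lerDl mdist_ge0. Qed.
Definition tensor_runit X : short_map (tensor X one_point) X :=
  ShortMap (@tensor_runit_short X).

Lemma tensor_runiti_short X :
  short (fun x : X => (x, tt) : tensor X one_point).
Proof. by move=> x y; rewrite tensor_distE /= mdistxx addr0. Qed.
Definition tensor_runiti X : short_map X (tensor X one_point) :=
  ShortMap (@tensor_runiti_short X).

Lemma tensor_braid_short X Y :
  short (fun a : tensor X Y => ((a : X * Y).2, (a : X * Y).1) : tensor Y X).
Proof. by move=> a b; rewrite !tensor_distE /= addrC. Qed.
Definition tensor_braid X Y : short_map (tensor X Y) (tensor Y X) :=
  ShortMap (@tensor_braid_short X Y).

Definition CMet : symmetric_monoidal_category.
Proof.
refine (@SymmetricMonoidalCategory (cmet_category R) tensor tensor_map one_point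
  tensor_assoc tensor_associ tensor_lunit tensor_luniti tensor_runit
  tensor_runiti tensor_braid _ _ _ _ _ _ _ _ _ _ _ _ _ _ _ _);
  move=> *; apply: short_map_eq; rewrite /=.
- by move=> [].
- by move=> [].
- by move=> [[]].
- by move=> [? []].
- by move=> [[]].
- by [].
- by move=> [? []].
- by [].
- by move=> [[]].
- by move=> [].
- by move=> [].
- by move=> [].
- by move=> [[]].
- by move=> [[[]]].
- by move=> [[]].
- by move=> [].
Defined.

End tensor.

(** * Radon measures and the Kantorovich metric *)

(* Measurable types are pointed in the library, hence the inhabitation witness
   [h]; the Borel sets themselves do not depend on it. *)
Definition pointed_space (R : realType) (X : metricType R) (h : $|X|) : Type :=
  X.

Section borel.
Variables (R : realType) (X : metricType R) (h : $|X|).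
HB.instance Definition _ := Choice.on (pointed_space h).
HB.instance Definition _ := isPointed.Build (pointed_space h) (unsquash h).
Definition borel := g_sigma_algebraType (@open X : set (set (pointed_space h))).
End borel.

(* [radon_first_moment] at [f] and at [fun x => `|f x|], which is short as well,
   makes every short [f] integrable.
   The library's measures are defined on all sets, not only on the measurable
   ones: [radon_junk] fixes the irrelevant values, so that two elements of
   [radon X] are equal as soon as they agree on Borel sets. *)
Record radon (R : realType) (X : metricType R) := Radon {
  radon_inhabited : $|X|;
  radon_prob :> probability (borel radon_inhabited) R;
  radon_regular : forall A : set (borel radon_inhabited), measurable A ->
    radon_prob A
    = ereal_sup [set radon_prob K | K in [set K : set X | compact K /\ K `<=` A]];
  radon_first_moment : forall f : X -> R, short (f : X -> R^o) ->
    (\int[radon_prob]_x (f x)%:E < +oo)%E;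
  radon_junk : forall A : set (borel radon_inhabited), ~ measurable A ->
    radon_prob A = 0%E }.

Definition expectation (R : realType) (X : metricType R) (p : radon X)
  (f : X -> R) : R := \int[radon_prob p]_x f x.

(* The set below is bounded when [X] is inhabited: short maps have finite
   integrals, and one may assume that [f] vanishes at a given point. *)
Definition kdist (R : realType) (X : metricType R) (p q : radon X) : R :=
  sup [set `|expectation p f - expectation q f|
      | f in [set f : X -> R | short (f : X -> R^o)]].

(** * The maps of the Kantorovich monad *)

Section kantorovich.
Variables (R : realType) (K : forall X : cmet R, is_complete_metric (@kdist R X)).
Implicit Types X Y : cmet R.

Definition kantorovich X : cmet R := cmet_of (K X).

Definition is_pushforward
    (Pmap : forall X Y, short_map X Y -> short_map (kantorovich X) (kantorovich Y))
    : Prop :=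
  forall X Y (f : short_map X Y) (p : radon X) (B : set Y), <<s open >> B ->
    radon_prob (Pmap X Y f p) B = radon_prob p (f @^-1` B).

Definition is_dirac (d : forall X, short_map X (kantorovich X)) : Prop :=
  forall X (x : X) (A : set X), <<s open >> A ->
    radon_prob (d X x) A = (\1_A x)%:E.

Definition is_barycenter
    (e : forall X, short_map (kantorovich (kantorovich X)) (kantorovich X))
    : Prop :=
  forall X (mu : radon (kantorovich X)) (f : X -> R), short (f : X -> R^o) ->
    expectation (e X mu) f = expectation mu (fun p : radon X => expectation p f).

Definition is_product_joint
    (n : forall X Y, short_map (tensor (kantorovich X) (kantorovich Y))
                       (kantorovich (tensor X Y))) : Prop :=
  forall X Y (p : radon X) (q : radon Y) (f : X * Y -> R),
    short (f : tensor X Y -> R^o) ->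
    expectation (n X Y (p, q)) f
    = expectation q (fun y => expectation p (fun x => f (x, y))).

Definition is_marginals
    (m : forall X Y, short_map (kantorovich (tensor X Y))
                       (tensor (kantorovich X) (kantorovich Y))) : Prop :=
  forall X Y (r : radon (tensor X Y)),
    let: (rX, rY) := m X Y r : radon X * radon Y in
    (forall f : X -> R, short (f : X -> R^o) ->
       expectation rX f = expectation r (fun a : X * Y => f a.1)) /\
    (forall g : Y -> R, short (g : Y -> R^o) ->
       expectation rY g = expectation r (fun a : X * Y => g a.2)).

End kantorovich.

(* Main.v *)
(** All measures needed here come from one Daniell-type representation theorem
    ([daniell_radon]): a positive normalized linear functional [I] on Lipschitz
    functions is integration against a Radon measure with finite first moment
    as soon as it is tight (for all [e, r > 0] some compact [K] satisfies
    [I (min(1, r d(-, K))) <= e]) and continuous along the truncations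
    [min(f, n)].  The outer
    measure of [A] is the infimum of [sup_n I(u_n)] over increasing sequences of
    bounded Lipschitz [u_n >= 0] that eventually reach [1] on [A]; tightness
    and completeness of the space give total mass [1].

    Completeness of [P X] is the case [I f = lim_p \int f dp] along a Cauchy
    filter, the multiplication [E mu] is the case
    [I f = \int (\int f dp) dmu(p)], and the product of [p] and [q] is the
    barycenter of the image of [q] under the short map sending [y] to the image
    of [p] under [x |-> (x, y)].  Since integrals of short maps determine a
    Radon measure, every equation of the monad becomes an equality of iterated
    integrals of short maps.  The only exchange of integrals needed holds for
    finitely supported measures by linearity, and in general because every
    integral is approximated, uniformly over short maps, by finite weighted sums
    of point evaluations. *)

From HB Require Import structures.
From mathcomp Require Import all_boot all_order all_algebra.
From mathcomp Require Import all_classical all_reals all_analysis.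
From mathcomp Require Import measurable_realfun ring lra.
Require Import Defs.

Set Implicit Arguments.
Unset Strict Implicit.
Unset Printing Implicit Defensive.

Import Order.TTheory GRing.Theory Num.Theory.
Import numFieldTopology.Exports numFieldNormedType.Exports.

Local Open Scope classical_set_scope.
Local Open Scope ring_scope.

(** * Lipschitz functions and means *)

Section lipschitz.
Variables (R : realType) (X : metricType R).
Implicit Types (f g : X -> R) (c d : R) (A : set X).

(* Exchanging [x] and [y] gives the bound on [`|f x - f y|]. *)
Definition klip c f := forall x y, f x - f y <= c * mdist x y.

(** Short functions are not closed under sums and multiples, so linear functionals are studied on
    all Lipschitz functions; dividing by a Lipschitz constant leads back to short ones. *)
Definition lip f := exists2 c : R, 0 <= c & klip c f.

(** Boundedness adds closure under products and integrability against every probability measure. *)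
Definition blip f := lip f /\ exists M : R, forall x, `|f x| <= M.

Lemma klip_norm c f x y : klip c f -> `|f x - f y| <= c * mdist x y.
Proof.
move=> fc; rewrite ler_norml fc andbT lerNl opprB.
by rewrite (le_trans (fc _ _))// metric_sym.
Qed.

Lemma shortP f : short (f : X -> R^o) <-> klip 1 f.
Proof.
split=> fc x y; last first.
  by rewrite [leLHS]/mdist/= distrC (le_trans (klip_norm _ _ fc))// mul1r.
rewrite mul1r (le_trans (ler_norm _))//.
by have := fc y x; rewrite [leLHS]/mdist/= metric_sym.
Qed.

Lemma short_lip f : short (f : X -> R^o) -> lip f.
Proof. by move/shortP; exists 1. Qed.

Lemma klip_le c d f : c <= d -> klip c f -> klip d f.
Proof.
by move=> cd fc x y; rewrite (le_trans (fc x y))// ler_wpM2r// mdist_ge0.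
Qed.

Lemma lip_gt0 f : lip f -> exists2 c, 0 < c & klip c f.
Proof.
move=> [c c0 fc]; exists (c + 1); first by rewrite ltr_wpDl.
by apply: klip_le fc; rewrite lerDl.
Qed.

Lemma klip_cst c a : 0 <= c -> klip c (cst a).
Proof. by move=> c0 x y; rewrite subrr mulr_ge0// mdist_ge0. Qed.

Lemma klipD c d f g : klip c f -> klip d g -> klip (c + d) (fun x => f x + g x).
Proof.
by move=> fc gd x y; have := fc x y; have := gd x y; rewrite mulrDl; lra.
Qed.

Lemma klipN c f : klip c f -> klip c (fun x => - f x).
Proof. by move=> fc x y; have := fc y x; rewrite metric_sym; lra. Qed.

Lemma klipZ c a f : klip c f -> klip (`|a| * c) (fun x => a * f x).
Proof.
move=> fc x y; rewrite -mulrBr (le_trans (ler_norm _))// normrM -mulrA.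
by rewrite ler_wpM2l// klip_norm.
Qed.

Lemma klip_scale_short c f : 0 < c -> klip c f ->
  short ((fun x => c^-1 * f x) : X -> R^o).
Proof.
move=> c0 fc; apply/shortP; have := klipZ c^-1 fc; apply: klip_le.
by rewrite gtr0_norm ?invr_gt0// mulVf// gt_eqF.
Qed.

Lemma klip_min c f g : klip c f -> klip c g -> klip c (fun x => Num.min (f x) (g x)).
Proof.
move=> fc gc x y; rewrite lerBlDl /Num.min; have := fc x y; have := gc x y.
by case: ltP => ?; case: ltP => ? ? ?; lra.
Qed.

Lemma klip_max c f g : klip c f -> klip c g -> klip c (fun x => Num.max (f x) (g x)).
Proof.
move=> fc gc x y; rewrite lerBlDl /Num.max; have := fc x y; have := gc x y.
by case: ltP => ?; case: ltP => ? ? ?; lra.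
Qed.

Lemma klip_abs c f : klip c f -> klip c (fun x => `|f x|).
Proof.
move=> fc x y; rewrite (le_trans _ (klip_norm x y fc))//.
exact: lerB_dist.
Qed.

Lemma klip_mdist a : klip 1 (fun x => mdist x a).
Proof. by move=> x y; rewrite mul1r lerBlDr metric_triangle. Qed.

Lemma lip_cst a : lip (cst a). Proof. by exists 0 => //; exact: klip_cst. Qed.

Lemma lipD f g : lip f -> lip g -> lip (fun x => f x + g x).
Proof.
by move=> [c c0 fc] [d d0 gd]; exists (c + d); [exact: addr_ge0|exact: klipD].
Qed.

Lemma lipN f : lip f -> lip (fun x => - f x).
Proof. by move=> [c c0 fc]; exists c => //; exact: klipN. Qed.

Lemma lipB f g : lip f -> lip g -> lip (fun x => f x - g x).
Proof. by move=> lf /lipN; exact: lipD. Qed.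

Lemma lipZ a f : lip f -> lip (fun x => a * f x).
Proof.
by move=> [c c0 fc]; exists (`|a| * c); [exact: mulr_ge0|exact: klipZ].
Qed.

Lemma lip_min f g : lip f -> lip g -> lip (fun x => Num.min (f x) (g x)).
Proof.
move=> [c c0 fc] [d d0 gd]; exists (c + d); first exact: addr_ge0.
by apply: klip_min; [apply: klip_le fc|apply: klip_le gd]; rewrite (lerDl, lerDr).
Qed.

Lemma lip_sum (I : Type) (s : seq I) (F : I -> X -> R) :
  (forall i, lip (F i)) -> lip (fun x => \sum_(i <- s) F i x).
Proof.
move=> lF; elim: s => [|i s IH].
  by under eq_fun do rewrite big_nil; exact: lip_cst.
by under eq_fun do rewrite big_cons; exact: lipD.
Qed.

Lemma lip_mdist a : lip (fun x => mdist x a).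
Proof. by exists 1 => //; exact: klip_mdist. Qed.

Lemma blip_lip f : blip f -> lip f. Proof. by case. Qed.

Lemma blip_cst a : blip (cst a).
Proof. by split; [exact: lip_cst|exists `|a|]. Qed.

Lemma blipD f g : blip f -> blip g -> blip (fun x => f x + g x).
Proof.
move=> [lf [M fM]] [lg [N gN]]; split; first exact: lipD.
by exists (M + N) => x; rewrite (le_trans (ler_normD _ _))// lerD.
Qed.

Lemma blipZ a f : blip f -> blip (fun x => a * f x).
Proof.
move=> [lf [M fM]]; split; first exact: lipZ.
by exists (`|a| * M) => x; rewrite normrM ler_wpM2l.
Qed.

Lemma blipN f : blip f -> blip (fun x => - f x).
Proof.
move=> [lf [M fM]]; split; first exact: lipN.
by exists M => x; rewrite normrN.
Qed.

Lemma blipB f g : blip f -> blip g -> blip (fun x => f x - g x).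
Proof. by move=> lf /blipN; exact: blipD. Qed.

Lemma blipM f g : blip f -> blip g -> blip (fun x => f x * g x).
Proof.
move=> [[c c0 fc] [M fM]] [[d d0 gd] [N gN]]; split; last first.
  by exists (M * N) => x; rewrite normrM ler_pM.
exists (`|M| * d + c * `|N|); first by rewrite addr_ge0// mulr_ge0.
move=> x y; rewrite (_ : _ - _ = f x * (g x - g y) + (f x - f y) * g y); last by lra.
rewrite (le_trans (ler_norm _))// (le_trans (ler_normD _ _))// !normrM.
rewrite [leRHS](_ : _ = `|M| * (d * mdist x y) + c * mdist x y * `|N|).
  by rewrite lerD// ler_pM ?klip_norm// ?(le_trans (fM x)) ?(le_trans (gN y)) ?ler_norm.
by lra.
Qed.

Lemma blip_sum (I : Type) (s : seq I) (F : I -> X -> R) :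
  (forall i, blip (F i)) -> blip (fun x => \sum_(i <- s) F i x).
Proof.
move=> lF; elim: s => [|i s IH].
  by under eq_fun do rewrite big_nil; exact: blip_cst.
by under eq_fun do rewrite big_cons; exact: blipD.
Qed.

Lemma ge0_blip_minr f a : lip f -> (forall x, 0 <= f x) -> 0 <= a ->
  blip (fun x => Num.min (f x) a).
Proof.
move=> lf f0 a0; split; first by apply: lip_min => //; exact: lip_cst.
exists a => x; rewrite ger0_norm ?ge_min ?lexx ?orbT// le_min f0 a0//.
Qed.

(** Stated for any filter converging to [x], because the Daniell construction needs it along an
    ultrafilter. *)
Lemma lip_cvg (F : set_system X) f x : Filter F -> lip f -> F --> x -> f @ F --> f x.
Proof.
move=> FF [c c0 fc] Fx; apply/cvgrPdist_lt => e e0.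
have c1 : 0 < c + 1 by rewrite ltr_wpDl.
move/metricType_numDomainType.fcvgrPdist_lt : Fx => /(_ (e / (c + 1))).
rewrite divr_gt0// => /(_ isT) Fx; near=> t.
rewrite (le_lt_trans (klip_norm _ _ fc))//.
have : mdist x t < e / (c + 1) by near: t.
rewrite ltr_pdivlMr//; have := mdist_ge0 x t; nra.
Unshelve. all: by end_near. Qed.

Lemma lip_continuous f : lip f -> continuous f.
Proof. by move=> lf x; apply: lip_cvg lf _. Qed.

(* Including [1] in the set caps the function at [1] and makes it constantly [1]
   when [A] is empty, where the library's [inf] of the empty set would be [0]. *)
Definition bump A (r : R) (x : X) : R := inf (1 |` [set r * mdist x a | a in A]).

Section bump.
Variables (A : set X) (r : R).
Hypothesis r0 : 0 <= r.

Let lb x : has_lbound (1 |` [set r * mdist x a | a in A]).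
Proof.
by exists 0 => _ [->//|[a Aa <-]]; rewrite mulr_ge0// mdist_ge0.
Qed.

Lemma bump_le1 x : bump A r x <= 1.
Proof. by apply: ge_inf => //; left. Qed.

Lemma bump_le a x : A a -> bump A r x <= r * mdist x a.
Proof. by move=> Aa; apply: ge_inf => //; right; exists a. Qed.

Lemma bump_ge c x : c <= 1 -> (forall a, A a -> c <= r * mdist x a) ->
  c <= bump A r x.
Proof.
move=> c1 ca; apply: lb_le_inf; first by exists 1; left.
by move=> _ [->//|[a Aa <-]]; exact: ca.
Qed.

Lemma bump_ge0 x : 0 <= bump A r x.
Proof. by apply: bump_ge => // a _; rewrite mulr_ge0// mdist_ge0. Qed.

Lemma bump_in x : A x -> bump A r x = 0.
Proof.
move=> Ax; apply/eqP; rewrite eq_le bump_ge0 andbT.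
by rewrite (le_trans (bump_le _ Ax))// mdistxx mulr0.
Qed.

Lemma bump_lt x c : bump A r x < c -> c <= 1 -> exists2 a, A a & r * mdist x a < c.
Proof.
move=> bc c1; apply: contrapT => h; move: bc; rewrite ltNge => /negP; apply.
apply: bump_ge => // a Aa; rewrite leNgt; apply/negP => rc; apply: h.
by exists a.
Qed.

Lemma bump_klip : klip r (bump A r).
Proof.
move=> x y; rewrite lerBlDl -lerBlDr; apply: bump_ge.
  rewrite lerBlDr (le_trans (bump_le1 _))// lerDl mulr_ge0// mdist_ge0//.
move=> a Aa; rewrite lerBlDr (le_trans (bump_le _ Aa))// -mulrDr ler_wpM2l//.
by rewrite addrC metric_triangle.
Qed.

Lemma bump_blip : blip (bump A r).
Proof.
split; first by exists r => //; exact: bump_klip.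
by exists 1 => x; rewrite ger0_norm ?bump_ge0 ?bump_le1.
Qed.

End bump.

Lemma bump_homo A r s x : 0 <= r -> r <= s -> bump A r x <= bump A s x.
Proof.
move=> r0 rs; apply: bump_ge; rewrite ?bump_le1 ?(le_trans r0)// => a Aa.
by rewrite (le_trans (bump_le _ _ Aa))// ler_wpM2r// mdist_ge0.
Qed.

Lemma bump_subset A B r x : 0 <= r -> A `<=` B -> bump B r x <= bump A r x.
Proof.
by move=> r0 AB; apply: bump_ge; rewrite ?bump_le1// => a /AB; exact: bump_le.
Qed.

(** Some ball of radius [e] around [x] misses [A], so any slope of at least [e^-1] lifts the bump to
    its cap at [x]. Thus the bumps of slope [n] increase to the indicator of an open complement, and
    attain it at a finite index at each point. *)
Lemma bump_far A x : open (~` A) -> ~ A x ->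
  exists n : nat, forall r, n%:R <= r -> bump A r x = 1.
Proof.
move=> oA nAx; have : nbhs x (~` A) by exact: open_nbhs_nbhs.
rewrite -metricType_numDomainType.filter_from_mdist_nbhs => -[e /= e0 eA].
exists (Num.truncn e^-1).+1 => r nr.
have er : e^-1 <= r by rewrite (le_trans _ nr)// ltW// truncnS_gt.
have r0 : 0 <= r by rewrite (le_trans _ er)// invr_ge0 ltW.
apply/eqP; rewrite eq_le bump_le1// bump_ge// => a Aa.
have ea : e <= mdist x a.
  by rewrite leNgt; apply/negP => /eA.
by rewrite -(mulVf (lt0r_neq0 e0)) ler_pM// ?invr_ge0 ltW.
Qed.

End lipschitz.

(** * Means: positive normalized linear functionals on Lipschitz functions *)

Section mean.
Variables (R : realType) (X : metricType R).
Implicit Types (f g : X -> R) (I : (X -> R) -> R).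

Record mean I : Prop := Mean {
  mean_lin : forall a f g, lip f -> lip g ->
    I (fun x => a * f x + g x) = a * I f + I g;
  mean_ge0 : forall f, lip f -> (forall x, 0 <= f x) -> 0 <= I f;
  mean_one : I (cst 1) = 1 }.

Variables (I : (X -> R) -> R) (mI : mean I).

Lemma mean_cst0 : I (cst 0) = 0.
Proof.
have := mean_lin mI (- 1) (lip_cst X 0) (lip_cst X 0).
by rewrite (_ : (fun _ => _) = cst 0); [lra|apply/funext => x /=; lra].
Qed.

Lemma meanZ a f : lip f -> I (fun x => a * f x) = a * I f.
Proof.
move=> lf; have := mean_lin mI a lf (lip_cst X 0); rewrite mean_cst0 addr0 => <-.
by congr I; apply/funext => x /=; rewrite addr0.
Qed.

Lemma meanD f g : lip f -> lip g -> I (fun x => f x + g x) = I f + I g.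
Proof.
move=> lf lg; have := mean_lin mI 1 lf lg; rewrite mul1r => <-.
by congr I; apply/funext => x /=; rewrite mul1r.
Qed.

Lemma meanN f : lip f -> I (fun x => - f x) = - I f.
Proof.
move=> lf; rewrite -mulN1r -meanZ//.
by congr I; apply/funext => x /=; rewrite mulN1r.
Qed.

Lemma meanB f g : lip f -> lip g -> I (fun x => f x - g x) = I f - I g.
Proof. by move=> lf lg; rewrite meanD ?meanN//; exact: lipN. Qed.

Lemma mean_cst a : I (cst a) = a.
Proof.
rewrite -[RHS]mulr1 -(mean_one mI) -meanZ; last exact: lip_cst.
by congr I; apply/funext => x /=; rewrite mulr1.
Qed.

Lemma le_mean f g : lip f -> lip g -> (forall x, f x <= g x) -> I f <= I g.
Proof.
move=> lf lg fg; rewrite -subr_ge0 -meanB//; apply: mean_ge0 => //.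
  exact: lipB.
by move=> x; rewrite subr_ge0.
Qed.

(** The error bound [h] is a function rather than a constant: finite approximations of an integral
    have an error that grows with the distance to a base point. *)
Lemma mean_dist f g h : lip f -> lip g -> lip h ->
  (forall x, `|f x - g x| <= h x) -> `|I f - I g| <= I h.
Proof.
move=> lf lg lh fgh; rewrite ler_norml -meanB// -meanN//.
apply/andP; split; apply: le_mean => //; try exact: lipN; try exact: lipB.
  by move=> x; have := fgh x; rewrite ler_norml => /andP[].
by move=> x; have := fgh x; rewrite ler_norml => /andP[].
Qed.

Lemma mean_sum (J : Type) (s : seq J) (F : J -> X -> R) :
  (forall j, lip (F j)) -> I (fun x => \sum_(j <- s) F j x) = \sum_(j <- s) I (F j).
Proof.
move=> lF; elim: s => [|j s IH].
  by rewrite big_nil; under eq_fun do rewrite big_nil; exact: mean_cst0.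
rewrite big_cons; under eq_fun do rewrite big_cons.
by rewrite meanD ?IH//; exact: lip_sum.
Qed.

End mean.

Lemma mean_ext (R : realType) (X : metricType R) (I J : (X -> R) -> R) :
  mean I -> mean J -> (forall f, short (f : X -> R^o) -> I f = J f) ->
  forall f, lip f -> I f = J f.
Proof.
move=> mI mJ IJ f lf; have [c c0 fc] := lip_gt0 lf.
have := IJ _ (klip_scale_short c0 fc); rewrite (meanZ mI)// (meanZ mJ)//.
by apply: mulfI; rewrite invr_neq0// gt_eqF.
Qed.

(** * Radon measures and the Kantorovich metric *)

Section measurable_part.
Context d (T : measurableType d) (R : realType) (P : probability T R).

(** Resets the values on non-measurable sets to [0], as [radon_junk] demands. *)
Definition measurable_part (A : set T) : \bar R :=
  if pselect (measurable A) then P A else 0%E.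

Lemma measurable_partE A : measurable A -> measurable_part A = P A.
Proof. by rewrite /measurable_part; case: pselect. Qed.

Let mp0 : measurable_part set0 = 0%E.
Proof. by rewrite measurable_partE// measure0. Qed.

Let mp_ge0 A : (0 <= measurable_part A)%E.
Proof. by rewrite /measurable_part; case: pselect => /= *; rewrite ?measure_ge0. Qed.

Let mp_additive : semi_sigma_additive measurable_part.
Proof.
move=> F mF tF mUF; rewrite measurable_partE//.
under eq_fun do under eq_bigr do rewrite measurable_partE//.
exact: measure_semi_sigma_additive.
Qed.

HB.instance Definition _ := isMeasure.Build _ _ _ measurable_part
  mp0 mp_ge0 mp_additive.

Let mpT : measurable_part setT = 1%E.
Proof. by rewrite measurable_partE// probability_setT. Qed.

HB.instance Definition _ := Measure_isProbability.Build _ _ _ measurable_part mpT.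

End measurable_part.

(** Besides its function, the bundled structure carries only propositions, which proof irrelevance
    identifies one by one. *)
Lemma eq_probability d (T : measurableType d) (R : realType)
  (P Q : probability T R) : (P = Q :> (set T -> \bar R)) -> P = Q.
Proof.
case: P Q => P cP [Q cQ] /= PQ; case: _ / PQ in cQ *; congr Probability.Pack.
case: cP cQ => [[P1 P2] [P3] [P4] [P5] [P6] [P7] [P8]].
move=> [[Q1 Q2] [Q3] [Q4] [Q5] [Q6] [Q7] [Q8]].
by rewrite (Prop_irrelevance Q1 P1) (Prop_irrelevance Q2 P2)
  (Prop_irrelevance Q3 P3) (Prop_irrelevance Q4 P4) (Prop_irrelevance Q5 P5)
  (Prop_irrelevance Q6 P6) (Prop_irrelevance Q7 P7) (Prop_irrelevance Q8 P8).
Qed.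

Lemma probability_setCE d (T : measurableType d) (R : realType)
    (P : probability T R) (A : set T) : measurable A -> P A = (1 - P (~` A))%E.
Proof.
move=> mA; have mAC := measurableC mA.
by rewrite -[in LHS](setCK A) probability_setC.
Qed.

Lemma probability_setC_le d (T : measurableType d) (R : realType)
    (P : probability T R) (A : set T) (e : R) : measurable A ->
  (1 - e%:E < P A -> P (~` A) <= e%:E)%E.
Proof.
move=> mA; rewrite probability_setC// -(fineK (fin_num_measure P A mA)).
by rewrite -!EFinB lte_fin lee_fin; lra.
Qed.

Lemma near_minr (R : realType) (a : R) :
  \forall n \near \oo, Num.min a n%:R = a.
Proof.
near=> n; apply/min_idPl; near: n; exact: nbhs_infty_ger.
Unshelve. all: by end_near. Qed.

Section borel_measure.
Variables (R : realType) (X : metricType R) (h : $|X|).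
Implicit Types (f g : X -> R).

Lemma open_borel (A : set X) : open A -> measurable (A : set (borel h)).
Proof. by move=> oA; exact: sub_sigma_algebra. Qed.

Lemma closed_borel (A : set X) : closed A -> measurable (A : set (borel h)).
Proof.
move=> cA; rewrite -[A]setCK; apply: measurableC; apply: open_borel.
exact: closed_openC.
Qed.

Lemma compact_borel (A : set X) : compact A -> measurable (A : set (borel h)).
Proof. move=> cA; apply: closed_borel; apply: compact_closed => //.
exact: (@metric_hausdorff R X).
Qed.

Lemma continuous_borel f : continuous f -> measurable_fun setT (f : borel h -> R).
Proof.
move=> cf; apply: (measurability _ (RGenOInfty.measurableE R)) => //.
move=> _ [_ [r ->] <-]; rewrite setTI; apply: open_borel.
by move/continuousP: cf; apply; exact: interval_open.
Qed.

Lemma lip_measurable f : lip f -> measurable_fun setT (f : borel h -> R).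
Proof. by move=> /lip_continuous; exact: continuous_borel. Qed.

Lemma blip_integrable (mu : probability (borel h) R) f : blip f ->
  mu.-integrable setT (EFin \o (f : borel h -> R)).
Proof.
move=> [lf [M fM]]; apply: measurable_bounded_integrable => //.
- by rewrite [ltLHS](probability_setT mu) ltry.
- exact: lip_measurable.
- by exists M; split; [exact: num_real|move=> N MN x _; exact: le_trans (fM x) (ltW MN)].
Qed.

(** Passing to [measurable_part mu] changes values off the Borel sets only, which no integral
    sees. *)
Lemma mk_radon (mu : probability (borel h) R) :
  (forall A : set (borel h), measurable A ->
    mu A = ereal_sup [set mu K | K in [set K : set X | compact K /\ K `<=` A]]) ->
  (forall f, short (f : X -> R^o) -> (\int[mu]_x (f x)%:E < +oo)%E) ->
  exists p : radon X, (forall A, <<s open >> A -> radon_prob p A = mu A) /\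
    forall f, expectation p f = \int[mu]_x f x.
Proof.
move=> mur muf.
pose nu2 := measurable_part mu.
have nuE A : measurable A -> nu2 A = mu A := @measurable_partE _ _ _ mu A.
have intE f : \int[nu2]_x f x = \int[mu]_x f x.
  by rewrite /Rintegral; congr fine; apply: eq_measure_integral => A mA _; exact: nuE.
have nur (A : set (borel h)) : measurable A -> nu2 A =
    ereal_sup [set nu2 K | K in [set K : set X | compact K /\ K `<=` A]].
  move=> mA; rewrite [LHS]nuE// mur//; congr ereal_sup.
  by apply/seteqP; split=> _ [K [cK KA] <-]; exists K => //;
    rewrite [nu2 K]nuE//; exact: compact_borel.
have nuf f : short (f : X -> R^o) -> (\int[nu2]_x (f x)%:E < +oo)%E.
  move=> /muf; congr (_ < _)%E; apply: eq_measure_integral => A mA _.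
  by rewrite [RHS]nuE.
have nuj (A : set (borel h)) : ~ measurable A -> nu2 A = 0%E.
  by move=> nmA; rewrite /nu2/= /measurable_part; case: pselect.
by exists (Radon nur nuf nuj).
Qed.

End borel_measure.

(** * Integration of Lipschitz functions against Radon measures *)

Section radon_expectation.
Variables (R : realType) (X : metricType R).
Implicit Types (f g : X -> R) (p q : radon X).

(** After rescaling [f] to a short function, its absolute value is short too, and the first moment
    condition applies to that. *)
Lemma lip_integrable p f : lip f ->
  (radon_prob p).-integrable setT (EFin \o (f : borel (radon_inhabited p) -> R)).
Proof.
move=> lf; have [c c0 fc] := lip_gt0 lf; pose g x := c^-1 * f x.
have sg : short (fun x => `|g x| : R^o).
  by apply/shortP/klip_abs/shortP; exact: klip_scale_short.
have -> : f = (fun x => c * g x).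
  by apply/funext => x; rewrite /g mulrA divff ?mul1r// gt_eqF.
have mg : measurable_fun setT (g : borel (radon_inhabited p) -> R).
  by apply: lip_measurable; exact: lipZ.
have ig : (radon_prob p).-integrable setT (EFin \o (g : borel (radon_inhabited p) -> R)).
  apply/integrableP; split; first exact/measurable_EFinP.
  by have := radon_first_moment p sg.
exact: (integrableZl measurableT c ig).
Qed.

Lemma expectation_mean p : mean (@expectation R X p).
Proof.
split.
- move=> a f g lf lg; rewrite /expectation RintegralD ?RintegralZl//;
  apply: lip_integrable => //; exact: lipZ.
- by move=> f _ f0; apply: Rintegral_ge0 => x _; exact: f0.
- rewrite /expectation Rintegral_cst//.
  by rewrite [X in fine X](probability_setT (radon_prob p)) mulr1.
Qed.

Lemma expectation_cst p a : expectation p (cst a) = a.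
Proof. exact: (mean_cst (expectation_mean p)). Qed.

Lemma EFin_expectation p f : lip f ->
  ((expectation p f)%:E = \int[radon_prob p]_x (f x)%:E)%E.
Proof.
move=> lf; rewrite /expectation /Rintegral fineK//.
by apply: integrable_fin_num => //; exact: lip_integrable.
Qed.

(** Inner regularity of the whole space gives a compact set of measure above [1 - e]. All bumps
    around it lie below the indicator of its complement, so one [K] serves every slope. *)
Lemma radon_tight p (e : R) : 0 < e -> exists2 K : set X, compact K &
  forall r : R, 0 <= r -> expectation p (bump K r) <= e.
Proof.
move=> e0; have : (1 - e%:E < radon_prob p setT)%E.
  by rewrite probability_setT -EFinB lte_fin ltrBlDr ltrDl.
rewrite radon_regular// => /ereal_sup_gt[_ [K [cK _] <-]] eK.
exists K => // r r0.
have mK : measurable (K : set (borel (radon_inhabited p))) by exact: compact_borel.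
rewrite -lee_fin EFin_expectation; last exact: blip_lip (bump_blip _ _).
apply: (@le_trans _ _ (\int[radon_prob p]_x (\1_(~` K) x)%:E)%E).
  apply: ge0_le_integral => //.
  - by move=> x _; rewrite lee_fin bump_ge0.
  - by apply/measurable_EFinP; apply: lip_measurable; exact: (blip_lip (bump_blip K r0)).
  - by apply/measurable_EFinP; apply: measurable_indic; exact: measurableC.
  - move=> x _; rewrite lee_fin indicE; have [Kx|nKx] := boolP (x \in ~` K).
      by rewrite bump_le1.
    by move: nKx; rewrite in_setC negbK inE => Kx; rewrite bump_in// ler0n.
rewrite integral_indic//; last exact: measurableC.
by rewrite setIT; exact: probability_setC_le eK.
Qed.

Lemma expectation_dominated_cvg p (u : nat -> X -> R) f g :
  (forall n, lip (u n)) -> lip f -> lip g -> (forall n x, `|u n x| <= g x) ->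
  (forall x, u n x @[n --> \oo] --> f x) ->
  expectation p (u n) @[n --> \oo] --> expectation p f.
Proof.
move=> lu lf lg ug uf.
suff H : (\int[radon_prob p]_x (u n x)%:E)%E @[n --> \oo] -->
    (expectation p f)%:E by exact: (fine_cvg H).
rewrite EFin_expectation//.
have mE k : lip k ->
    measurable_fun setT (fun x : borel (radon_inhabited p) => (k x)%:E).
  by move=> lk; apply/measurable_EFinP; exact: lip_measurable.
have [] := @dominated_convergence _ _ _ (radon_prob p) setT measurableT
  (fun n x => (u n x)%:E) (fun x => (f x)%:E) (fun x => (g x)%:E)
  (fun n => mE _ (lu n)) (mE _ lf) _ (lip_integrable p lg) _ => //.
- apply: aeW => x _; apply: cvg_EFin; last exact: uf.
  exact: nearW.
- by apply: aeW => x n _; rewrite /= lee_fin.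
Qed.

Lemma ge0_lip_expectation_cvg p f : lip f -> (forall x, 0 <= f x) ->
  expectation p (fun x => Num.min (f x) n%:R) @[n --> \oo] --> expectation p f.
Proof.
move=> lf f0; apply: (expectation_dominated_cvg (g := f)) => //.
- by move=> n; apply: lip_min => //; exact: lip_cst.
- by move=> n x; rewrite ger0_norm ?ge_min ?lexx// le_min f0 ler0n.
- move=> x; apply: cvg_near_cst.
  by apply: filterS (near_minr (f x)) => n ->.
Qed.

(** Recovers measures of open sets from Lipschitz integrals: the bumps converge pointwise to the
    indicator and are dominated by [1]. *)
Lemma expectation_bump_cvg p (A : set X) : open (~` A) ->
  (expectation p (bump A n%:R))%:E @[n --> \oo] --> radon_prob p (~` A).
Proof.
move=> oA; have mA := @open_borel _ _ (radon_inhabited p) _ oA.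
have lb n : lip (bump A n%:R) by exact: (blip_lip (bump_blip A (ler0n R n))).
under eq_fun do rewrite EFin_expectation//.
have -> : radon_prob p (~` A) = (\int[radon_prob p]_x (\1_(~` A) x)%:E)%E.
  by rewrite integral_indic// setIT.
have [] := @dominated_convergence _ _ _ (radon_prob p) setT measurableT
  (fun n x => (bump A n%:R x)%:E) (fun x => (\1_(~` A) x)%:E) (cst 1%E)
  _ _ _ _ _ => //.
- by move=> n; apply/measurable_EFinP; exact: lip_measurable.
- by apply/measurable_EFinP; exact: measurable_indic.
- apply: aeW => x _; apply: cvg_near_cst; rewrite indicE.
  have [nAx|Ax] := boolP (x \in ~` A); last first.
    move: Ax; rewrite in_setC negbK inE => Ax.
    by apply: nearW => n; rewrite bump_in.
  move: nAx; rewrite inE => /(bump_far oA)[N NA].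
  by exists N => // n /= Nn; rewrite NA// ler_nat.
- by apply: (lip_integrable p (lip_cst X 1)).
- apply: aeW => x n _; rewrite /= lee_fin ger0_norm ?bump_le1// bump_ge0//.
Qed.

(** Equality of integrals passes from short to Lipschitz functions by scaling, then to complements
    of compact sets as limits of bumps, then to Borel sets by inner regularity; elsewhere both
    measures vanish. *)
Lemma radon_ext p q :
  (forall f, short (f : X -> R^o) -> expectation p f = expectation q f) -> p = q.
Proof.
move=> pq; have lpq := mean_ext (expectation_mean p) (expectation_mean q) pq.
have cpq (K : set X) : compact K -> radon_prob p K = radon_prob q K.
  move=> cK; have cK' : closed K.
    by apply: compact_closed => //; exact: (@metric_hausdorff R X).
  have oK : open (~` K) by exact: closed_openC.
  have mK := @compact_borel _ _ (radon_inhabited p) _ cK.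
  have pq' : radon_prob p (~` K) = radon_prob q (~` K).
    have := @expectation_bump_cvg p K oK; under eq_fun => n do rewrite
      (lpq _ (blip_lip (bump_blip K (ler0n R n)))).
    by move=> /cvg_lim <- //; exact/cvg_lim/expectation_bump_cvg.
  apply: (etrans (probability_setCE _ mK)); rewrite [X in (1 - X)%E]pq'.
  by apply/esym/probability_setCE; exact: compact_borel.
have apq (A : set X) : radon_prob p A = radon_prob q A.
  have [mA|nmA] := pselect (<<s open >> A); last first.
    by rewrite (@radon_junk _ _ p A nmA) (@radon_junk _ _ q A nmA).
  rewrite (@radon_regular _ _ p A mA) (@radon_regular _ _ q A mA).
  by congr ereal_sup; apply/seteqP; split=> _ [K [cK KA] <-]; exists K => //; rewrite cpq.
(* The Borel space is indexed by the inhabitation witness, so the two witnesses are identified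
   before the measures. *)
case: p q apq {pq lpq cpq} => hp p rp fp jp [hq q rq fq jq] /= apq.
have hpq : hp = hq by exact: Prop_irrelevance.
case: _ / hpq in q rq fq jq apq *.
have pq : p = q.
  by apply/eq_probability/funext.
case: _ / pq in rq fq jq *.
by congr Radon; exact: Prop_irrelevance.
Qed.

(** The supremum defining [kdist] is over a bounded set: the integral of a short [g] differs from
    [g x0] by at most the mean distance to [x0]. *)
Lemma expectation_kdist p q f : short (f : X -> R^o) ->
  `|expectation p f - expectation q f| <= kdist p q.
Proof.
move=> sf; apply: ub_le_sup; last by exists f.
have [x0] := radon_inhabited p.
exists (expectation p (mdist^~ x0) + expectation q (mdist^~ x0)) => _ [g sg <-].
have lg := short_lip sg; have lc := lip_cst X (g x0); have ld := lip_mdist x0.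
have gd x : `|g x - g x0| <= mdist x x0.
  by move/shortP : sg => /(klip_norm x x0); rewrite mul1r.
have dist s : `|expectation s g - g x0| <= expectation s (mdist^~ x0).
  by rewrite -(expectation_cst s (g x0)) (mean_dist (expectation_mean s)).
rewrite (_ : _ - _ = (expectation p g - g x0) - (expectation q g - g x0)).
  by rewrite (le_trans (ler_normB _ _))// lerD.
by lra.
Qed.

Lemma kdist_le p q c :
  (forall f, short (f : X -> R^o) -> `|expectation p f - expectation q f| <= c) ->
  kdist p q <= c.
Proof.
move=> pqc; apply: ge_sup; last by move=> _ [f sf <-]; exact: pqc.
exists `|expectation p (cst 0) - expectation q (cst 0)|, (cst 0) => //.
by apply/shortP; exact: klip_cst.
Qed.

Lemma expectation_klip r p q f : 0 < r -> klip r f ->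
  `|expectation p f - expectation q f| <= r * kdist p q.
Proof.
move=> r0 fr; have lf : lip f by exists r => //; exact: ltW.
have := expectation_kdist p q (klip_scale_short r0 fr).
rewrite !(meanZ (expectation_mean _))// -mulrBr normrM gtr0_norm ?invr_gt0//.
by rewrite ler_pdivrMl.
Qed.

Lemma kdist_is_metric : is_metric (@kdist R X).
Proof.
split.
- move=> p; apply/eqP; rewrite eq_le; apply/andP; split.
    by apply: kdist_le => f _; rewrite subrr normr0.
  (* Testing against the zero function shows that the distance is nonnegative. *)
  have /(expectation_kdist p p) : short (cst 0 : X -> R^o).
    by apply/shortP; exact: klip_cst.
  by rewrite subrr normr0.
- move=> p q pq0; apply: radon_ext => f /(expectation_kdist p q).
  by rewrite pq0 normr_le0 subr_eq0 => /eqP.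
- by move=> p q; rewrite /kdist; under eq_imagel do rewrite distrC.
- move=> q p r; apply: kdist_le => f sf.
  rewrite -(subrKA (expectation q f)) (le_trans (ler_normD _ _))//.
  by rewrite lerD// expectation_kdist.
Qed.

End radon_expectation.
(** * The Daniell construction *)

Lemma ultra_fmap (T U : Type) (f : T -> U) (F : set_system T) :
  UltraFilter F -> UltraFilter (f @ F).
Proof.
move=> FU; split; first exact: fmap_proper_filter.
move=> G GF FG; apply/seteqP; split=> A; last exact: FG.
move=> GA; have [//|/(FG (~` A)) GnA] := in_ultra_setVsetC (f @^-1` A) FU.
have : G (A `&` ~` A) by exact: filterI.
by rewrite setICr => /(@filter_not_empty _ G GF).
Qed.

(** Sending each point near [K] to a close point of [K] gives an ultrafilter on a compact set, which
    converges; [F] then contains a small ball around the limit. As this holds at every scale, [F] is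
    Cauchy. *)
Lemma ultra_tight_cvg (R : realType) (X : cmet R) (F : set_system X) :
  UltraFilter F ->
  (forall e : R, 0 < e -> exists2 K : set X, compact K &
     F [set x | exists2 a, K a & mdist x a < e]) ->
  exists x : X, F --> x.
Proof.
move=> FU Ftight; apply: cmet_complete; apply: cauchy_exP => e e0.
have e2 : 0 < e / 2 by rewrite divr_gt0.
have [K cK FK] := Ftight _ e2.
have /choice[y yP] (x : X) : exists y : X,
    (exists2 a, K a & mdist x a < e / 2) -> K y /\ mdist x y < e / 2.
  have [[a Ka xa]|nK] := pselect (exists2 a, K a & mdist x a < e / 2).
    by exists a.
  (* Default value at points far from [K]; [F] concentrates on the others. *)
  by exists x => /nK.
have yFU := ultra_fmap y FU.
have yFK : F (y @^-1` K) by apply: filterS FK => x /yP[].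
move: cK; rewrite compact_ultra => /(_ _ yFU yFK)[a [Ka ya]].
exists a; rewrite /= ballEmdist.
have ya' : \forall x \near F, mdist a (y x) < e / 2.
  exact: (metricType_numDomainType.cvgr_dist_lt ya).
apply: filterS2 FK ya' => x /yP[_ xy] ay /=.
rewrite (le_lt_trans (metric_triangle _ (y x) _))// (splitr e) ltrD//.
by rewrite metric_sym.
Qed.

Lemma sum_half_powers (R : realType) (e : R) n :
  \sum_(k < n) e / 2 ^+ k.+1 = e - e / 2 ^+ n.
Proof.
elim: n => [|n IH]; first by rewrite big_ord0 expr0 divr1 subrr.
rewrite big_ord_recr/= IH exprS invfM; lra.
Qed.

(** * The outer measure of a mean *)

Section daniell.
Variables (R : realType) (X : cmet R) (I : (X -> R) -> R).
Implicit Types (f g : X -> R) (A B : set X).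

(** Sequences are used because the indicator of an open set is in general only an increasing limit
    of Lipschitz functions. Asking for the value [1] at a finite index avoids pointwise limits. *)
Definition covering A (c : R) := exists u : nat -> X -> R,
  [/\ forall n, blip (u n), forall n x, 0 <= u n x,
      forall x, nondecreasing_seq (u^~ x), forall n, I (u n) <= c &
      forall x, A x -> exists n, 1 <= u n x].

Definition outer A : R := inf [set c | covering A c].

Hypothesis mI : mean I.

Lemma covering_ge0 A c : covering A c -> 0 <= c.
Proof.
move=> [u [ub u0 _ uc _]]; rewrite (le_trans _ (uc 0%N))//.
by apply: mean_ge0 => //; exact: blip_lip.
Qed.

(** Keeps the infimum defining [outer] over a nonempty set, and bounds it by [1]. *)
Lemma covering1 A : covering A 1.
Proof.
exists (fun _ => cst 1); split=> [n|n x|x m n _|n|x _] //.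
- exact: blip_cst.
- by rewrite mean_one.
- by exists 0%N.
Qed.

Lemma covering_has_inf A : has_inf [set c | covering A c].
Proof.
split; first by exists 1; exact: covering1.
by exists 0 => c /covering_ge0.
Qed.

Lemma outer_le A c : covering A c -> outer A <= c.
Proof. by move=> Ac; apply: ge_inf => //; case: (covering_has_inf A). Qed.

Lemma outer_ge0 A : 0 <= outer A.
Proof.
apply: lb_le_inf; first by case: (covering_has_inf A).
by move=> c /covering_ge0.
Qed.

Lemma outer_covering A (e : R) : 0 < e -> exists2 c, covering A c & c < outer A + e.
Proof. by move=> e0; exact: inf_adherent e0 (covering_has_inf A). Qed.

Lemma covering_cst A f c : blip f -> (forall x, 0 <= f x) -> I f <= c ->
  (forall x, A x -> 1 <= f x) -> covering A c.
Proof.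
move=> bf f0 fc Af; exists (fun=> f); split=> [n|n x|x m n _|n|x /Af] //.
by exists 0%N.
Qed.

Lemma outer_set0 : outer set0 = 0.
Proof.
apply/eqP; rewrite eq_le outer_ge0 andbT; apply: outer_le.
apply: (@covering_cst _ (cst 0)) => //; first exact: blip_cst.
by rewrite (mean_cst mI).
Qed.

Lemma le_outer A B : A `<=` B -> outer A <= outer B.
Proof.
move=> AB; apply: lb_le_inf; first by case: (covering_has_inf B).
move=> c [u [ub u0 und uc uB]]; apply: outer_le; exists u; split=> //.
by move=> x /AB; exact: uB.
Qed.

(** Cover [F i] up to an error [e / 2 ^ i.+1] and combine diagonally: the [n]th function sums the
    [n]th terms of the first [n] covers. This is again an increasing sequence, with values of [I]
    below the sum of all costs. *)
Lemma outer_sigma_subadditive (F : (set X)^nat) :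
  ((outer (\bigcup_n F n))%:E <= \sum_(n <oo) (outer (F n))%:E)%E.
Proof.
apply/lee_addgt0Pr => e e0.
have e2 n : 0 < e / (2 ^ n.+1)%:R by rewrite divr_gt0// ltr0n expn_gt0.
have /choice[c cP] n : exists c, covering (F n) c /\ c < outer (F n) + e / (2 ^ n.+1)%:R.
  by have [c Fc cF] := outer_covering (F n) (e2 n); exists c.
have c0 n : (0 <= (c n)%:E)%E by rewrite lee_fin (covering_ge0 (cP n).1).
apply: (@le_trans _ _ (\sum_(n <oo) (c n)%:E)%E); last first.
  apply: le_trans (epsilon_trick _ _ (ltW e0)); last first.
    by move=> n; rewrite lee_fin outer_ge0.
  by apply: lee_nneseries => // n _; rewrite -EFinD lee_fin ltW// (cP n).2.
have [->|cfin] := eqVneq (\sum_(n <oo) (c n)%:E)%E +oo%E; first exact: leey.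
have Sfin : (\sum_(n <oo) (c n)%:E)%E \is a fin_num.
  by rewrite ge0_fin_numE ?ltey//; exact: nneseries_ge0.
have /choice[u uP] n := (cP n).1.
rewrite -(fineK Sfin) lee_fin; apply: outer_le.
exists (fun n x => \sum_(i < n) u i n x); split.
- by move=> n; apply: blip_sum => i; case: (uP i).
- by move=> n x; apply: sumr_ge0 => i _; case: (uP i).
- move=> x m n mn; rewrite (@le_trans _ _ (\sum_(i < m) u i n x))//.
    by apply: ler_sum => i _; case: (uP i) => _ _ + _ _; exact.
  rewrite -!(big_mkord xpredT (fun i => u i n x)) (big_cat_nat (leq0n m) mn)//= lerDl.
  by apply: sumr_ge0 => i _; case: (uP i).
- move=> n; rewrite mean_sum//; last by move=> i; case: (uP i) => /(_ n)/blip_lip.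
  rewrite (@le_trans _ _ (\sum_(i < n) c i))//.
    by apply: ler_sum => i _; case: (uP i).
  rewrite -lee_fin fineK// -sumEFin -(big_mkord xpredT (fun i => (c i)%:E)).
  by apply: nneseries_lim_ge.
- move=> x [i _ Fx]; case: (uP i) => _ ui0 uind _ /(_ _ Fx)[n un].
  (* Late enough for the [i]th cover to enter the sum and to have reached [1] at [x]. *)
  exists (maxn i.+1 n); have ilt : (i < maxn i.+1 n)%N by rewrite leq_max leqnn.
  rewrite (bigD1 (Ordinal ilt))//= (le_trans un)//.
  rewrite (le_trans (uind x _ _ (leq_maxr i.+1 n)))// lerDl.
  by apply: sumr_ge0 => j _; case: (uP j).
Qed.

(** A cover [u] of [B] is split by the bumps [phi] around the complement of [A]: the products
    [u n * phi n] cover the part in [A], and [u n * (1 - phi m)] with one fixed large [m] covers the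
    rest. The two costs add up to that of [u], up to [e / 2]. *)
Lemma outer_open_caratheodory A B : open A ->
  outer (B `&` A) + outer (B `&` ~` A) <= outer B.
Proof.
move=> oA; apply/ler_addgt0Pr => e e0; have e2 : 0 < e / 2 by rewrite divr_gt0.
have [c [u [ub u0 und uc uB]] cB] := outer_covering B e2.
pose phi n := bump (~` A) n%:R.
have phib n : blip (phi n) by exact: bump_blip.
have phi0 n x : 0 <= phi n x by exact: bump_ge0.
have phi1 n x : phi n x <= 1 by exact: bump_le1.
have phind x : nondecreasing_seq (phi^~ x).
  by move=> m n mn; apply: bump_homo => //; rewrite ler_nat.
pose v n x := u n x * phi n x.
have vb n : blip (v n) by exact: blipM.
have vnd x : nondecreasing_seq (v^~ x) by move=> m n mn; rewrite ler_pM// ?und ?phind.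
pose s := sup (range (fun n => I (v n))).
have vc n : I (v n) <= c.
  rewrite (le_trans _ (uc n))//; apply: le_mean => //; try exact: blip_lip.
  by move=> x; rewrite ler_piMr.
have vs : has_sup (range (fun n => I (v n))).
  by split; [exists (I (v 0%N)), 0%N|exists c => _ [n _ <-]].
(* The index [m] is chosen so that [I (v m)] exceeds [s - e / 2]. *)
have [_ [m _ <-] sm] := sup_adherent e2 vs.
have As : covering (B `&` A) s.
  exists v; split=> //.
  - by move=> n x; rewrite mulr_ge0.
  - by move=> n; apply: ub_le_sup; [case: vs|exists n].
  - move=> x [/uB[n un] Ax].
    have oAC : open (~` ~` A) by rewrite setCK.
    have nACx : ~ (~` A) x by move=> /(_ Ax).
    have [k kP] := bump_far oAC nACx.
    exists (maxn n k); rewrite /v /phi kP ?mulr1 ?ler_nat ?leq_maxr//.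
    by rewrite (le_trans un)// und// leq_maxl.
have ACs : covering (B `&` ~` A) (c - s + e / 2).
  have wE n x : u n x * (1 - phi m x) = u n x - u n x * phi m x by rewrite mulrBr mulr1.
  have wb n : blip (fun x => u n x * (1 - phi m x)).
    by apply: blipM => //; apply: blipB => //; exact: blip_cst.
  have wnd x : nondecreasing_seq (fun n => u n x * (1 - phi m x)).
    by move=> i j ij; rewrite ler_wpM2r ?subr_ge0// und.
  exists (fun n x => u n x * (1 - phi m x)); split=> //.
  - by move=> n x; rewrite mulr_ge0// subr_ge0.
  (* Raising the index to at least [m] makes the subtracted product dominate [v m]. *)
  - move=> n; apply: (@le_trans _ _ (I (fun x => u (maxn n m) x * (1 - phi m x)))).
      by apply: le_mean => //; [exact: blip_lip..|move=> x; exact/wnd/leq_maxl].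
    under eq_fun do rewrite wE.
    have ubm : blip (fun x => u (maxn n m) x * phi m x) by exact: blipM.
    rewrite (@meanB _ _ _ mI (u (maxn n m))); [|exact: blip_lip..].
    have : I (v m) <= I (fun x => u (maxn n m) x * phi m x).
      apply: le_mean => //; [exact: blip_lip..|move=> x].
      by rewrite ler_wpM2r// und// leq_maxr.
    by have := uc (maxn n m); move: sm; rewrite -/s => *; lra.
  - move=> x [/uB[n un] nAx]; exists n.
    by rewrite /phi bump_in ?subr0 ?mulr1.
have := outer_le As; have := outer_le ACs; lra.
Qed.

End daniell.

(** * Tightness and the total mass *)

Section daniell_tight.
Variables (R : realType) (X : cmet R) (I : (X -> R) -> R).
Implicit Types (f g : X -> R) (A B : set X).
Hypothesis mI : mean I.
Hypothesis tightI : forall e r : R, 0 < e -> 0 <= r ->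
  exists2 K : set X, compact K & I (bump K r) <= e.

(** The budget [e] is shared geometrically, while the slopes [k.+1] grow so that points where all
    bumps are below [1] lie near compact sets at every scale. *)
Lemma tight_sequence (e : R) : 0 < e -> exists2 K : nat -> set X,
  forall k, compact (K k) &
  forall n, I (fun x => \sum_(k < n) bump (K k) k.+1%:R x) <= e.
Proof.
move=> e0.
have ek0 k : 0 < e / 2 ^+ k.+1 by rewrite divr_gt0// exprn_gt0.
have /choice[K KP] k : exists K : set X,
    compact K /\ I (bump K k.+1%:R) <= e / 2 ^+ k.+1.
  by have [K cK IK] := tightI (ek0 k) (ler0n R k.+1); exists K.
exists K => [k|n]; first exact: (KP k).1.
rewrite (mean_sum mI); last by move=> k; exact: blip_lip (bump_blip _ (ler0n _ _)).
apply: (@le_trans _ _ (\sum_(k < n) e / 2 ^+ k.+1)).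
  by apply: ler_sum => k _; exact: (KP k).2.
by rewrite sum_half_powers gerBl divr_ge0 ?exprn_ge0// ltW.
Qed.

(** A bump of slope [k.+1] below its cap means a distance below [1 / k.+1] to [K k]; taking [k] to
    be the integer part of [e^-1] makes this less than [e]. *)
Lemma near_tight_cvg (K : nat -> set X) (F : set_system X) : UltraFilter F ->
  (forall k, compact (K k)) ->
  (forall k, F [set x | bump (K k) k.+1%:R x < 1]) -> exists x : X, F --> x.
Proof.
move=> FU cK FK; apply: ultra_tight_cvg => // e e0.
pose k := Num.truncn e^-1; exists (K k) => //.
apply: filterS (FK k) => x /bump_lt[]// a Ka xa; exists a => //.
have ke : e^-1 < k.+1%:R by exact: truncnS_gt.
rewrite ltNge; apply/negP => exa; move: xa; rewrite ltNge => /negP; apply.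
by rewrite -[leLHS](mulVf (lt0r_neq0 e0)) ler_pM ?invr_ge0 ?(ltW e0) ?(ltW ke).
Qed.

(* The step of the Daniell construction that uses tightness and completeness:
   if the increasing cover [u] stayed below [1 - e] at points [x_n] lying near
   the compacts [K 0], ..., [K n], it would do so at a cluster point. *)
Lemma covering_setT c : covering I setT c -> 1 <= c.
Proof.
move=> [u [ub u0 und uc uT]]; apply/ler_addgt0Pr => e e0.
have e2 : 0 < e / 2 by rewrite divr_gt0.
have [K cK IK] := tight_sequence e2.
have psi0 k x : 0 <= bump (K k) k.+1%:R x by exact: bump_ge0.
have psib k : blip (bump (K k) k.+1%:R) by exact: bump_blip.
(* Applying [I] to this uniform bound gives [1 - e / 2 <= c + e / 2]. *)
suff [n nP] : exists n, forall x,
    1 - e / 2 <= u n x + \sum_(k < n) bump (K k) k.+1%:R x.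
  have lsum : lip (fun x => \sum_(k < n) bump (K k) k.+1%:R x).
    by apply: lip_sum => k; exact: blip_lip.
  have lu := blip_lip (ub n).
  have := le_mean mI (lip_cst X (1 - e / 2)) (lipD lu lsum) nP.
  by rewrite (mean_cst mI) (meanD mI)//; have := uc n; have := IK n => *; lra.
apply: contrapT => /forallNP nP.
have /choice[x xP] n : exists x,
    u n x + \sum_(k < n) bump (K k) k.+1%:R x < 1 - e / 2.
  apply: contrapT => /forallNP xn; apply: (nP n) => x.
  by rewrite leNgt; exact/negP/xn.
(* [G] contains every property that holds at [x n] for all large [n]. *)
have [G [GU FG]] := ultraFilterLemma (fmap_proper_filter x eventually_filter).
have Gx (P : set X) N : (forall n, (N <= n)%N -> P (x n)) -> G P.
  by move=> NP; apply: FG; exists N.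
have [|z Gz] := near_tight_cvg GU cK.
  move=> k; apply: (Gx _ k.+1) => n kn /=.
  rewrite (le_lt_trans _ (lt_trans (xP n) _)) ?gtrBl//.
  rewrite (bigD1 (Ordinal kn))//= addrCA lerDl addr_ge0//.
  exact: sumr_ge0.
have [m] := uT z Logic.I; rewrite leNgt => /negP; apply.
suff : u m z <= 1 - e / 2 by move=> ?; lra.
have GF : ProperFilter G by exact: ultra_proper.
apply: (cvgr_to_le (lip_cvg _ (blip_lip (ub m)) Gz)).
apply: (Gx _ m) => n mn /=; rewrite ltW// (le_lt_trans _ (xP n))//.
by rewrite (le_trans (und _ _ _ mn))// lerDl sumr_ge0.
Qed.
End daniell_tight.

(** * The Daniell measure: integral and regularity *)

Section daniell_measure.
Variables (R : realType) (X : cmet R) (I : (X -> R) -> R) (h : $|X|).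
Implicit Types (f g : X -> R) (A B : set X).
Hypothesis mI : mean I.
Hypothesis tightI : forall e r : R, 0 < e -> 0 <= r ->
  exists2 K : set X, compact K & I (bump K r) <= e.

Lemma outer_setT : outer I setT = 1.
Proof.
apply/eqP; rewrite eq_le (outer_le mI (covering1 mI _))/=.
apply: lb_le_inf; first by case: (covering_has_inf mI setT).
by move=> c; exact: covering_setT.
Qed.

Lemma outerU A B : outer I (A `|` B) <= outer I A + outer I B.
Proof.
apply/ler_addgt0Pr => e e0; have e2 : 0 < e / 2 by rewrite divr_gt0.
have [c [u [ub u0 und uc uA]] cA] := outer_covering mI A e2.
have [d [v [vb v0 vnd vd vB]] dB] := outer_covering mI B e2.
suff /(outer_le mI) : covering I (A `|` B) (c + d) by lra.
exists (fun n x => u n x + v n x); split.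
- by move=> n; exact: blipD.
- by move=> n x; exact: addr_ge0.
- by move=> x m n mn; rewrite lerD ?und ?vnd.
- by move=> n; rewrite (meanD mI) ?lerD//; exact: blip_lip.
- move=> x [/uA|/vB] [n un]; exists n; rewrite (le_trans un)//.
    by rewrite lerDl.
  by rewrite lerDr.
Qed.

Definition outer_measure_of : {outer_measure set (pointed_space h) -> \bar R} :=
  HB.pack (fun A : set (pointed_space h) => (outer I A)%:E)
    (isOuterMeasure.Build R (pointed_space h)
      (fun A : set (pointed_space h) => (outer I A)%:E)
      (congr1 EFin (outer_set0 mI)) (fun A => outer_ge0 mI A)
      (fun A B => @le_outer _ _ _ mI A B) (outer_sigma_subadditive mI)).

Lemma borel_caratheodory A : <<s open >> A ->
  caratheodory_measurable outer_measure_of A.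
Proof.
move: A; apply: smallest_sub.
  split.
  - exact: caratheodory_measurable_set0.
  - by move=> A mA; rewrite setTD; exact: caratheodory_measurable_setC.
  - by move=> F mF; exact: caratheodory_measurable_bigcup.
move=> A oA; apply: le_caratheodory_measurable => B.
by rewrite -EFinD lee_fin; exact: outer_open_caratheodory.
Qed.

Definition daniell (A : set (borel h)) : \bar R := (outer I A)%:E.

Let daniell0 : daniell set0 = 0%E. Proof. by rewrite /daniell outer_set0. Qed.

Let daniell_ge0 A : (0 <= daniell A)%E. Proof. by rewrite lee_fin outer_ge0. Qed.

Let daniell_additive : semi_sigma_additive daniell.
Proof.
move=> F mF tF mUF.
apply: (@caratheodory_measure_sigma_additive _ _ outer_measure_of) => //.
- by move=> n; apply: borel_caratheodory; exact: mF.
- exact: borel_caratheodory.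
Qed.

HB.instance Definition _ := isMeasure.Build _ _ _ daniell
  daniell0 daniell_ge0 daniell_additive.

Let daniellT : daniell setT = 1%E.
Proof. by rewrite /daniell outer_setT. Qed.

HB.instance Definition _ := Measure_isProbability.Build _ _ _ daniell daniellT.

Let dint f : blip f -> daniell.-integrable setT (EFin \o (f : borel h -> R)).
Proof. exact: blip_integrable. Qed.

Lemma daniell_intD f g : blip f -> blip g ->
  \int[daniell]_x (f x + g x) = \int[daniell]_x f x + \int[daniell]_x g x.
Proof. by move=> bf bg; rewrite RintegralD//; exact: dint. Qed.

Lemma daniell_int_cst a : \int[daniell]_x (cst a x) = a.
Proof.
rewrite Rintegral_cst//.
by rewrite [X in fine X](probability_setT daniell) mulr1.
Qed.

Lemma le_daniell_int f g : blip f -> blip g -> (forall x, f x <= g x) ->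
  \int[daniell]_x f x <= \int[daniell]_x g x.
Proof. by move=> bf bg fg; apply: le_Rintegral => //; exact: dint. Qed.

(* Slicing [f] into layers of height [eta]: the integral of the layer above
   level [n.+1 * eta] is at most [eta] times the measure of the set where the
   layer just below is full, hence at most the value of [I] on that layer. *)
Lemma daniell_slices f (eta : R) n : blip f -> (forall x, 0 <= f x) -> 0 < eta ->
  \int[daniell]_x (Num.min (f x) (n.+1%:R * eta)) <=
  eta + I (fun x => Num.min (f x) (n%:R * eta)).
Proof.
move=> bf f0 eta0; have bm k : blip (fun x => Num.min (f x) (k%:R * eta)).
  by apply: ge0_blip_minr => //; [exact: blip_lip|rewrite mulr_ge0// ltW].
elim: n => [|n IH].
  (* At [n = 0] the truncation under [I] is zero, and the extra [eta] pays for the bottom layer. *)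
  rewrite [X in I X](_ : _ = cst 0).
    rewrite (mean_cst mI) addr0 -[leRHS]daniell_int_cst.
    apply: le_daniell_int => //; first exact: blip_cst.
    by move=> x /=; rewrite mul1r ge_min lexx orbT.
  by apply/funext => x; rewrite mul0r; apply/min_idPr.
pose g x := Num.min (f x) (n.+2%:R * eta) - Num.min (f x) (n.+1%:R * eta).
pose k x := Num.min (f x) (n.+1%:R * eta) - Num.min (f x) (n%:R * eta).
have bg : blip g by exact: blipB.
have bk : blip k by exact: blipB.
have nE m : m.+1%:R * eta = m%:R * eta + eta by rewrite -natr1 mulrDl mul1r.
have k0 x : 0 <= k x.
  by rewrite subr_ge0 le_min !ge_min lexx/= nE lerDl (ltW eta0) orbT.
pose A := [set x | n.+1%:R * eta <= f x].
have kA x : A x -> k x = eta.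
  by rewrite /A/= /k => Ax; rewrite !(min_idPr _)// ?nE; move: Ax; rewrite nE; lra.
have gA x : g x <= eta * \1_A x.
  rewrite indicE /g; have [xA|xA] := boolP (x \in A).
    rewrite mulr1 (nE n.+1); move: xA; rewrite inE /A/= => Ax.
    by rewrite (min_idPr Ax) lerBlDl ge_min lexx orbT.
  move: xA; rewrite notin_setE /A/= => /negP; rewrite -ltNge => /ltW Ax.
  by rewrite mulr0 (min_idPl Ax) subr_le0 ge_min lexx.
have cA : closed A.
  have /continuous_closedP := lip_continuous (blip_lip bf).
  by move=> /(_ _ (@closed_ge _ (n.+1%:R * eta))).
have mA := @closed_borel _ _ h _ cA.
have gI : \int[daniell]_x g x <= I k.
  have i1 : daniell.-integrable setT (EFin \o (\1_A : borel h -> R)).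
    exact: integrable_indic.
  apply: (@le_trans _ _ (eta * outer I A)).
    rewrite (_ : eta * _ = \int[daniell]_x (eta * \1_A x)).
      apply: le_Rintegral => //; first exact: dint.
      by apply: (integrableZl measurableT eta i1).
    by rewrite RintegralZl// /Rintegral integral_indic// setIT.
  rewrite -ler_pdivlMl//; apply: outer_le => //.
  apply: (@covering_cst _ _ _ _ (fun x => eta^-1 * k x)) => //.
  - exact: blipZ.
  - by move=> x; rewrite mulr_ge0// invr_ge0 ltW.
  - by rewrite (meanZ mI)//; exact: blip_lip.
  - by move=> x /kA ->; rewrite mulVf// gt_eqF.
have -> : (fun x => Num.min (f x) (n.+2%:R * eta)) =
          (fun x => Num.min (f x) (n.+1%:R * eta) + g x).
  by apply/funext => x; rewrite /g addrC subrK.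
rewrite daniell_intD//.
have : I k = I (fun x => Num.min (f x) (n.+1%:R * eta)) - 
             I (fun x => Num.min (f x) (n%:R * eta)).
  by rewrite (meanB mI)//; exact: blip_lip.
by move=> Ik; rewrite (le_trans (lerD IH gI))// Ik -addrA lerD2l addrC subrK.
Qed.


(** Slices of height [e] up to the bound of [f]: both truncations in [daniell_slices] are then [f]
    itself, leaving only the error [e]. *)
Lemma daniell_int_le f : blip f -> (forall x, 0 <= f x) ->
  \int[daniell]_x f x <= I f.
Proof.
move=> bf f0; apply/ler_addgt0Pr => e e0; case: (bf) => _ [M fM].
pose n := Num.truncn (M / e); have Mn k : (n.+1 <= k)%N -> M <= k%:R * e.
  move=> nk; rewrite -ler_pdivrMr// ltW// (lt_le_trans (truncnS_gt _))//.
  by rewrite ler_nat.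
have fE k : (n.+1 <= k)%N -> (fun x => Num.min (f x) (k%:R * e)) = f.
  move=> nk; apply/funext => x; apply/min_idPl.
  by rewrite (le_trans (ler_norm _))// (le_trans (fM x))// Mn.
have := daniell_slices n.+1 bf f0 e0.
by rewrite (fE n.+1)// (fE n.+2)// addrC.
Qed.

(** The one-sided bound for the nonnegative functions [f + M] and [M - f] gives both
    inequalities. *)
Lemma daniell_int f : blip f -> \int[daniell]_x f x = I f.
Proof.
move=> bf; case: (bf) => lf [M fM].
have bM := blip_cst X M; have lM := lip_cst X M.
have Mf x : - M <= f x <= M by rewrite -ler_norml.
apply/eqP; rewrite eq_le; apply/andP; split.
  have := daniell_int_le (blipD bf bM); rewrite daniell_intD//.
  rewrite daniell_int_cst (meanD mI)// (mean_cst mI) lerD2r; apply => x /=.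
  by rewrite -lerBlDr sub0r; case/andP: (Mf x).
have := daniell_int_le (blipD bM (blipN bf)); rewrite daniell_intD//; last exact: blipN.
rewrite daniell_int_cst (meanD mI)//; last exact: lipN.
rewrite (mean_cst mI) (meanN mI)// lerD2l.
rewrite (_ : \int[daniell]_x (- f x) = - \int[daniell]_x f x).
  by rewrite lerN2; apply => x /=; rewrite subr_ge0; case/andP: (Mf x).
under eq_Rintegral do rewrite -mulN1r.
by rewrite RintegralZl ?mulN1r//; exact: dint.
Qed.

(** [K0] collects the points where every bump is at most [1 / 2]. It is closed and its ultrafilters
    converge, so it is compact. Off [K0] some bump exceeds [1 / 2], so twice the partial sums of
    bumps cover the complement; the budget [e / 2] absorbs the factor. *)
Lemma outer_tight (e : R) : 0 < e -> exists2 K : set X, compact K &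
  outer I (~` K) <= e.
Proof.
move=> e0; have e2 : 0 < e / 2 by rewrite divr_gt0.
have [K cK IK] := tight_sequence mI tightI e2.
have psib k : blip (bump (K k) k.+1%:R) by exact: bump_blip.
have psi0 k x : 0 <= bump (K k) k.+1%:R x by exact: bump_ge0.
pose K0 := \bigcap_k [set x | bump (K k) k.+1%:R x <= 1 / 2].
have cK0 : closed K0.
  apply: closed_bigI => k _.
  have /continuous_closedP := lip_continuous (blip_lip (psib k)).
  by move=> /(_ _ (@closed_le _ (1 / 2))).
exists K0.
  rewrite compact_ultra => F FU FK0.
  have [|z Fz] := near_tight_cvg FU cK.
    by move=> k; apply: filterS FK0 => x /(_ k Logic.I)/= xk; lra.
  exists z; split=> //; apply: cK0 => B /Fz FB.
  exact: (filter_ex (filterI FK0 FB)).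
apply: (outer_le mI); exists (fun n x => 2 * \sum_(k < n) bump (K k) k.+1%:R x).
have bs n : blip (fun x => \sum_(k < n) bump (K k) k.+1%:R x).
  by apply: blip_sum => k; exact: psib.
split.
- by move=> n; exact: blipZ.
- by move=> n x; rewrite mulr_ge0// sumr_ge0.
- move=> x m n mn; rewrite ler_wpM2l//.
  rewrite -!(big_mkord xpredT (fun k => bump (K k) k.+1%:R x)).
  by rewrite (big_cat_nat (leq0n m) mn)//= lerDl sumr_ge0.
- move=> n; rewrite (meanZ mI); last exact: blip_lip.
  by rewrite mulrC -ler_pdivlMr.
- move=> x /existsNP[k /not_implyP[_ /negP]]; rewrite -ltNge => xk.
  exists k.+1; rewrite -ler_pdivrMl// mulr1 -div1r (le_trans (ltW xk))//.
  by rewrite big_ord_recr/= lerDr sumr_ge0.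
Qed.

(** The closed set is the complement of an open [U] containing the complement of [A]. Scaling a
    cover by [1 + d] turns the condition of reaching [1] into a strict, hence open, one. *)
Lemma outer_closed_approx A (e : R) : <<s open >> A -> 0 < e ->
  exists F : set X, [/\ closed F, F `<=` A & outer I A <= outer I F + e].
Proof.
move=> mA e0; pose d := Num.min 1 (e / 3).
have d0 : 0 < d by rewrite lt_min ltr01 divr_gt0.
have d1 : d <= 1 by rewrite ge_min lexx.
have de : d <= e / 3 by rewrite ge_min lexx orbT.
have [c [u [ub u0 und uc uA]] cA] := outer_covering mI (~` A) d0.
pose U := \bigcup_n [set x | 1 < (1 + d) * u n x].
have bu n : blip (fun x => (1 + d) * u n x) by exact: blipZ.
have oU : open U.
  apply: bigcup_open => n _.
  have /continuousP := lip_continuous (blip_lip (bu n)).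
  by move=> /(_ _ (@open_gt _ 1)).
have AU : ~` U `<=` A.
  move=> x; apply: contra_notP => /uA[n un]; exists n => //=.
  by rewrite (lt_le_trans _ (ler_wpM2l _ un))// ?mulr1; lra.
exists (~` U); split=> //; first exact: open_closedC.
have cU : covering I U ((1 + d) * c).
  exists (fun n x => (1 + d) * u n x); split=> //.
  - by move=> n x; rewrite mulr_ge0//; lra.
  - by move=> x m n mn; rewrite ler_wpM2l ?und//; lra.
  - move=> n; rewrite (meanZ mI) ?ler_wpM2l//; [lra|exact: blip_lip].
  - by move=> x [n _ /= /ltW]; exists n.
have UU : 1 <= outer I U + outer I (~` U).
  by rewrite -outer_setT -(setUv U); exact: outerU.
have UD := outer_le mI cU.
have AD : outer I A = 1 - outer I (~` A).
  have mA' : measurable (A : set (borel h)) by [].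
  exact: (congr1 fine (probability_setCE daniell mA')).
have A0 := outer_ge0 mI A.
have c0 : 0 <= c by apply: (covering_ge0 mI (A := ~` A)); exists u.
have c2 : c <= 2 by lra.
nra.
Qed.

(** Intersecting an inner closed approximation with a compact set carrying almost all the mass gives
    an inner compact one. *)
Lemma daniell_regular (A : set (borel h)) : measurable A ->
  daniell A = ereal_sup [set daniell K | K in [set K : set X | compact K /\ K `<=` A]].
Proof.
move=> mA; apply/eqP; rewrite eq_le; apply/andP; split; last first.
  apply: ge_ereal_sup => _ [K [cK KA] <-].
  by rewrite lee_fin; exact: (le_outer mI).
apply/lee_addgt0Pr => e e0; have e2 : 0 < e / 2 by rewrite divr_gt0.
have [F [cF FA AF]] := outer_closed_approx mA e2.
have [K cK Ke] := outer_tight e2.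
have cFK : compact (F `&` K) by rewrite setIC; exact: compact_closedI.
apply: (@le_trans _ _ (daniell (F `&` K) + e%:E)%E).
  rewrite -EFinD lee_fin.
  have : outer I F <= outer I (F `&` K) + outer I (~` K).
    apply: le_trans (outerU _ _); apply: (le_outer mI) => x Fx.
    by have [Kx|nKx] := pselect (K x); [left|right].
  by lra.
apply: leeD2r; apply: ereal_sup_ubound; exists (F `&` K) => //.
by split=> // x [/FA].
Qed.

Lemma daniell_probability : exists mu : probability (borel h) R,
  (forall f, blip f -> \int[mu]_x f x = I f) /\
  forall A : set (borel h), measurable A ->
  mu A = ereal_sup [set mu K | K in [set K : set X | compact K /\ K `<=` A]].
Proof. by exists daniell; split; [exact: daniell_int|exact: daniell_regular]. Qed.

End daniell_measure.

(** * Representation of means by Radon measures *)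

Section representation.
Variables (R : realType) (X : cmet R) (I : (X -> R) -> R).
Implicit Types (f g : X -> R).
Hypothesis mI : mean I.

(** On an empty space all functions coincide, but [I] separates the constants [0] and [1]. *)
Lemma mean_inhabited : $|X|.
Proof.
apply: contrapT => nX; have X0 (x : X) : False by exact: nX (squash x).
have : I (cst 1) = I (cst 0) by congr I; apply/funext => x; case: (X0 x).
by rewrite !(mean_cst mI) => /eqP; rewrite oner_eq0.
Qed.

(** The Daniell measure represents [I] on bounded functions. Nonnegative short functions follow by
    truncation, with monotone convergence for the measure and the second assumption for [I]; a
    general short function is the difference of its positive and negative parts. *)
Theorem daniell_radon :
  (forall e r : R, 0 < e -> 0 <= r ->
    exists2 K : set X, compact K & I (bump K r) <= e) ->
  (forall f, short (f : X -> R^o) -> (forall x, 0 <= f x) ->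
    I (fun x => Num.min (f x) n%:R) @[n --> \oo] --> I f) ->
  exists p : radon X, forall f, short (f : X -> R^o) -> expectation p f = I f.
Proof.
move=> tightI cvgI; have h := mean_inhabited.
have [mu [muI mur]] := daniell_probability h mI tightI.
have muE f : blip f -> (\int[mu]_x (f x)%:E = (I f)%:E)%E.
  move=> bf; rewrite -muI// /Rintegral fineK//.
  by apply: integrable_fin_num => //; exact: blip_integrable.
have mu_ge0 f : short (f : X -> R^o) -> (forall x, 0 <= f x) ->
    (\int[mu]_x (f x)%:E = (I f)%:E)%E.
  move=> sf f0; have lf := short_lip sf.
  have bm n : blip (fun x => Num.min (f x) n%:R) by exact: ge0_blip_minr.
  have mf g : lip g -> measurable_fun setT (fun x : borel h => (g x)%:E).
    by move=> lg; apply/measurable_EFinP; exact: lip_measurable.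
  have H : (\int[mu]_x (Num.min (f x) n%:R)%:E)%E @[n --> \oo] -->
      (\int[mu]_x (f x)%:E)%E.
    have fE x : limn (fun n => (Num.min (f x) n%:R)%:E) = (f x)%:E.
      apply/cvg_lim => //; apply: cvg_near_cst.
      by apply: filterS (near_minr (f x)) => n ->.
    under [in X in _ --> X]eq_integral do rewrite -fE.
    apply: cvg_monotone_convergence => //.
    - by move=> n; apply: mf; exact: blip_lip.
    - by move=> n x _; rewrite lee_fin le_min f0/=.
    - move=> x _ m n mn; rewrite lee_fin le_min !ge_min lexx/=.
      by rewrite ler_nat mn orbT.
  have IE : (I (fun x => Num.min (f x) n%:R))%:E @[n --> \oo] --> (I f)%:E.
    by apply: cvg_EFin; [exact: nearW|exact: cvgI].
  move: H; under eq_fun do rewrite muE//.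
  by move=> /cvg_lim <- //; exact/cvg_lim.
have muy f : short (f : X -> R^o) -> (\int[mu]_x (f x)%:E < +oo)%E.
  move=> sf; have saf : short (fun x => `|f x| : R^o).
    by apply/shortP/klip_abs/shortP.
  have mf : measurable_fun setT (EFin \o (f : borel h -> R)).
    by apply/measurable_EFinP; apply: lip_measurable; exact: (short_lip sf).
  have := le_abse_integral mu measurableT mf.
  rewrite (_ : (\int[mu]_x `|(EFin \o f) x|)%E = (I (fun x => `|f x|))%:E).
    by move=> fI; rewrite (le_lt_trans (lee_abs _))// (le_lt_trans fI)// ltry.
  by rewrite -mu_ge0.
have [p [_ pE]] := mk_radon mur muy.
exists p => f sf; have s0 : short (cst 0 : X -> R^o) by apply/shortP/klip_cst.
have sp : short (fun x => Num.max (f x) 0 : R^o).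
  by apply/shortP; apply: klip_max; [exact/shortP|exact: klip_cst].
have sn : short (fun x => Num.max (- f x) 0 : R^o).
  by apply/shortP; apply: klip_max; [apply/klipN/shortP|exact: klip_cst].
have ge0E g : short (g : X -> R^o) -> (forall x, 0 <= g x) -> expectation p g = I g.
  by move=> sg g0; rewrite pE /Rintegral mu_ge0.
have fE : f = (fun x => Num.max (f x) 0 - Num.max (- f x) 0).
  by apply/funext => x; rewrite /Num.max; case: ltP => ?; case: ltP => ?; lra.
have lp := short_lip sp; have ln := short_lip sn.
rewrite fE (meanB (expectation_mean p))// (meanB mI)//.
by rewrite !ge0E// => x; rewrite le_max lexx orbT.
Qed.

End representation.

Section approximation.
Variables (R : realType) (X : cmet R) (I : (X -> R) -> R).
Implicit Types (f g : X -> R).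
Hypothesis mI : mean I.
Hypothesis approxI : forall e : R, 0 < e -> exists p : radon X,
  forall f, short (f : X -> R^o) -> `|expectation p f - I f| <= e.

(** Tightness and continuity along truncations hold for each approximating measure and pass to [I],
    because the approximation is uniform over short functions. *)
Theorem approx_radon :
  exists p : radon X, forall f, short (f : X -> R^o) -> expectation p f = I f.
Proof.
apply: daniell_radon => //.
(* Dividing by [r + 1], which is positive even for [r = 0], makes the bump short. *)
- move=> e r e0 r0; have r1 : 0 < r + 1 by rewrite ltr_wpDl.
  have e2 : 0 < e / 2 by rewrite divr_gt0.
  have [p pI] := approxI (divr_gt0 e2 r1).
  have [K cK pK] := radon_tight p e2; exists K => //.
  have lb := blip_lip (bump_blip K r0).
  have br1 : klip (r + 1) (bump K r) by apply: klip_le (bump_klip K r0); rewrite lerDl.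
  have sb := klip_scale_short r1 br1.
  have := pI _ sb; rewrite (meanZ mI)// (meanZ (expectation_mean p))//.
  rewrite -mulrBr normrM gtr0_norm ?invr_gt0// mulrC ler_pM2r ?invr_gt0//.
  by rewrite ler_norml => /andP[+ _]; have := pK _ r0 => ? ?; lra.
- move=> f sf f0; apply/cvgrPdist_le => e e0.
  have e3 : 0 < e / 3 by rewrite divr_gt0.
  have [p pI] := approxI e3.
  have /cvgrPdist_le/(_ _ e3) := @ge0_lip_expectation_cvg _ _ p f (short_lip sf) f0.
  apply: filterS => n; rewrite !ler_norml => /andP[pn1 pn2].
  have sm : short (fun x => Num.min (f x) n%:R : R^o).
    by apply/shortP; apply: klip_min; [exact/shortP|exact: klip_cst].
  move: (pI _ sf) (pI _ sm); rewrite !ler_norml => /andP[a1 a2] /andP[b1 b2].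
  by apply/andP; split; lra.
Qed.

End approximation.
(** * Completeness, images and Dirac measures *)

Section kdist_complete.
Variables (R : realType) (X : cmet R).
Let PX : metricType R := metrized (@kdist_is_metric R X).

(** The integrals of each Lipschitz function converge along the filter. Being Cauchy for [kdist]
    makes this uniform over short functions, which is what [approx_radon] needs and what gives
    convergence to the measure found. *)
Lemma kdist_complete : complete_space PX.
Proof.
move=> F FF cF.
have near_p (e : R) : 0 < e -> exists p : PX, F [set q : PX | kdist p q < e].
  move=> e0; have [p] := (cauchyP F).1 cF e e0.
  by rewrite ballEmdist; exists p.
have cvgE f : lip f -> cvg ((fun p : PX => expectation p f : R) @ F).
  move=> /lip_gt0[c c0 fc].
  apply: cauchy_cvg; apply: cauchy_exP => e e0.
  have [p Fp] := near_p _ (divr_gt0 e0 c0).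
  exists (expectation p f).
  suff: F [set q : PX | ball (expectation p f : R) e (expectation q f : R)] by [].
  apply: filterS Fp => q /= pq.
  rewrite /ball/= (le_lt_trans (expectation_klip p q c0 fc))//.
  by rewrite mulrC -ltr_pdivlMr.
pose I f : R := lim ((fun p : PX => expectation p f : R) @ F).
have IE f : lip f -> (fun p : PX => expectation p f : R) @ F --> I f.
  exact: cvgE.
have mI : mean I.
  split.
  - move=> a f g lf lg; apply: cvg_lim => //.
    under eq_fun do rewrite (mean_lin (expectation_mean _))//.
    by apply: cvgD; [apply: cvgM; [exact: cvg_cst|exact: IE]|exact: IE].
  - move=> f lf f0; apply: limr_ge; first exact: cvgE.
    by apply: nearW => p; exact: (mean_ge0 (expectation_mean p) lf f0).
  - by rewrite /I; under eq_fun do rewrite expectation_cst; exact: lim_cst.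
have pI (p : PX) e f : F [set q : PX | kdist p q < e] -> short (f : X -> R^o) ->
    `|expectation p f - I f| <= e.
  move=> Fp sf.
  have cvgn : `|expectation p f - expectation q f| @[q --> F] -->
      `|expectation p f - I f|.
    by apply: cvg_norm; apply: cvgB; [exact: cvg_cst|apply/IE/short_lip].
  apply: (cvgr_to_le cvgn); apply: filterS Fp => q /= pq.
  by rewrite (le_trans (expectation_kdist p q sf))// ltW.
have [|p pE] := approx_radon mI.
  by move=> e e0; have [p Fp] := near_p _ e0; exists p => f; exact: pI.
exists p; apply/metricType_numDomainType.fcvgrPdist_lt => e e0.
have e3 : 0 < e / 3 by rewrite divr_gt0.
have [q Fq] := near_p _ e3; apply: filterS (Fq) => r /= qr.
apply: (@le_lt_trans _ _ (e / 3 + e / 3)); last by lra.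
rewrite [leLHS]/(kdist p r); apply: kdist_le => f sf.
rewrite pE// -(subrKA (expectation q f)) (le_trans (ler_normD _ _))// lerD//.
  by rewrite distrC pI.
by rewrite (le_trans (expectation_kdist q r sf))// ltW.
Qed.

Lemma kdist_is_complete_metric : is_complete_metric (@kdist R X).
Proof. exists (@kdist_is_metric R X); exact: kdist_complete. Qed.

End kdist_complete.

(** * Push-forwards and Dirac measures *)

Section image.
Variables (R : realType) (X Y : metricType R).

Lemma short_fun_lip (f : short_map X Y) (g : Y -> R) : lip g -> lip (fun x => g (f x)).
Proof.
move=> [c c0 gc]; exists c => // x y; rewrite (le_trans (gc _ _))//.
by rewrite ler_wpM2l// short_funP.
Qed.

Lemma short_fun_short (f : short_map X Y) (g : Y -> R) :
  short (g : Y -> R^o) -> short ((fun x => g (f x)) : X -> R^o).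
Proof. by move=> sg x y; rewrite (le_trans (sg _ _))// short_funP. Qed.

Lemma short_fun_continuous (f : short_map X Y) : continuous f.
Proof.
move=> x; apply/metricType_numDomainType.cvgrPdist_lt => e e0.
have xx : nbhs x --> x by exact: cvg_refl.
have /metricType_numDomainType.fcvgrPdist_lt/(_ _ e0) := xx.
by apply: filterS => t; exact: le_lt_trans (short_funP f _ _).
Qed.

(** A compact set inside the preimage of [B] has a compact image inside [B] of at least the same
    measure, so inner regularity is inherited. *)
Lemma radon_image (f : short_map X Y) (p : radon X) : exists q : radon Y,
  (forall B, <<s open >> B -> radon_prob q B = radon_prob p (f @^-1` B)) /\
  forall g, lip g -> expectation q g = expectation p (fun x => g (f x)).
Proof.
pose hX := radon_inhabited p; have fc := @short_fun_continuous f.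
have hY : $|Y| by case: hX => x; exact: squash (f x).
have mf : measurable_fun setT (f : borel hX -> borel hY).
  apply: (@measurability _ _ (borel hX) (borel hY) setT f (@open Y) erefl).
  move=> _ [B oB <-]; rewrite setTI.
  by apply: open_borel; move/continuousP: (@short_fun_continuous f); exact.
have mpre B : <<s open >> B -> <<s open >> (f @^-1` B).
  by move=> mB; have := mf measurableT B mB; rewrite setTI.
pose fM : {mfun borel hX >-> borel hY} :=
  HB.pack (f : borel hX -> borel hY) (isMeasurableFun.Build _ _ _ _ _ mf).
pose mu := distribution (radon_prob p) fM.
have mur (B : set (borel hY)) : measurable B ->
    mu B = ereal_sup [set mu K | K in [set K : set Y | compact K /\ K `<=` B]].
  move=> mB; apply/eqP; rewrite eq_le; apply/andP; split; last first.
    apply: ge_ereal_sup => _ [K [cK KB] <-].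
    by apply: le_measure => //; rewrite inE//; exact: compact_borel.
  rewrite {1}/mu /distribution /pushforward (radon_regular (mpre _ mB)).
  apply: ge_ereal_sup => _ [K [cK KB] <-].
  apply: (@le_trans _ _ (mu (f @` K))).
    apply: le_measure; rewrite ?inE.
    - exact: compact_borel.
    - apply: mpre; apply: (@compact_borel _ _ hY).
      by apply: continuous_compact => //; exact: continuous_subspaceT fc.
    - by move=> x Kx; exists x.
  apply: ereal_sup_ubound; exists (f @` K) => //; split.
    by apply: continuous_compact => //; exact: continuous_subspaceT fc.
  by move=> _ [x /KB ? <-].
have muE g : lip g -> (\int[mu]_y (g y)%:E = \int[radon_prob p]_x (g (f x))%:E)%E.
  move=> lg; apply: (@integral_distribution _ _ _ _ _ (radon_prob p) fM
    (fun y : borel hY => (g y)%:E)).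
    by apply/measurable_EFinP; apply: lip_measurable.
  exact: (lip_integrable p (short_fun_lip f lg)).
have [|q [qE qI]] := mk_radon mur.
  move=> g sg; rewrite muE; last exact: short_lip.
  exact: (radon_first_moment p (short_fun_short f sg)).
by exists q; split=> // g lg; rewrite qI /Rintegral muE.
Qed.

Lemma radon_dirac (x : X) : exists p : radon X,
  (forall A, <<s open >> A -> radon_prob p A = (\1_A x)%:E) /\
  forall g, lip g -> expectation p g = g x.
Proof.
have h : $|X| := squash x.
pose mu : probability (borel h) R := dirac (x : borel h).
have muE g : lip g -> (\int[mu]_y (g y)%:E = (g x)%:E)%E.
  move=> lg; rewrite integral_dirac//; last first.
    by apply/measurable_EFinP; apply: lip_measurable.
  by rewrite diracT mul1e.
have mur (A : set (borel h)) : measurable A ->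
    mu A = ereal_sup [set mu K | K in [set K : set X | compact K /\ K `<=` A]].
  move=> mA; apply/eqP; rewrite eq_le; apply/andP; split; last first.
    apply: ge_ereal_sup => _ [K [cK KA] <-].
    by apply: le_measure => //; rewrite inE//; exact: compact_borel.
  have [Ax|nAx] := pselect (A x).
    apply: ereal_sup_ubound; exists [set x].
      by split; [exact: compact_set1|move=> _ ->].
    by rewrite /mu/= !diracE !mem_set.
  apply: ereal_sup_ubound; exists set0; first by split; [exact: compact0|].
  by rewrite /mu/= !diracE !memNset.
have [|p [pE pI]] := mk_radon mur.
  by move=> g /short_lip lg; rewrite muE// ltry.
exists p; split=> [A mA|g lg]; first by rewrite pE.
by rewrite pI /Rintegral muE.
Qed.

End image.
(** * Finite approximation and barycenters *)

Lemma mean_klip (R : realType) (X Y : metricType R) (I : (Y -> R) -> R)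
    (f : X -> Y -> R) (c : R) : mean I ->
  (forall x, lip (f x)) -> (forall y, klip c (f^~ y)) -> klip c (fun x => I (f x)).
Proof.
move=> mI lf fc x x'; rewrite -(meanB mI)// -[leRHS](mean_cst mI).
by apply: le_mean => //; [exact: lipB|exact: lip_cst|move=> y; exact: fc].
Qed.

(** Without a finite net, the sets of points of [A] at distance at least [e] from a finite part of
    [A] generate a proper filter. A cluster point [z] contradicts its member [far [:: z]]. *)
Lemma compact_net (R : realType) (X : metricType R) (A : set X) (e : R) :
  compact A -> 0 < e -> exists s : seq X, forall x, A x ->
    exists2 a, a \in s & A a /\ mdist x a < e.
Proof.
move=> cA e0; apply: contrapT => nnet.
pose far (s : seq X) := [set x | A x /\ forall a, a \in s -> e <= mdist x a].
pose F := filter_from [set s : seq X | forall a, a \in s -> A a] far.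
have FF : ProperFilter F.
  apply: filter_from_proper.
    apply: filter_from_filter; first by exists [::].
    move=> s t sA tA; exists (s ++ t).
      by move=> a; rewrite mem_cat => /orP[/sA|/tA].
    by move=> x [Ax xst]; split; split=> // a ast; apply: xst;
      rewrite mem_cat ast ?orbT.
  move=> s sA; apply: contrapT => nfar; apply: nnet; exists s => x Ax.
  apply: contrapT => nx; apply: nfar; exists x; split=> // a sa.
  rewrite leNgt; apply/negP => xa; apply: nx; exists a => //.
  by split=> //; exact: sA.
have [|z [Az zF]] := cA F FF; first by exists [::] => // x [].
have Fz : F (far [:: z]) by exists [:: z] => // a; rewrite inE => /eqP ->.
have [x [[_ /(_ z)]]] := zF _ _ Fz (nbhsx_ballx z _ e0).
rewrite inE eqxx => /(_ isT); rewrite ballEmdist/= metric_sym leNgt => /negP.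
exact.
Qed.

Section finite_approximation.
Variables (R : realType) (X : metricType R).
Implicit Types (f : X -> R).

(* Greedy Lipschitz partition of unity subordinate to the balls around [s]. *)
Lemma lip_partition (x0 : X) (r : R) (s : seq X) : 0 < r ->
  exists n (phi : nat -> X -> R) (b : nat -> X),
  (forall i, blip (phi i)) /\ forall f, short (f : X -> R^o) -> forall x,
    `|f x - \sum_(i < n) phi i x * f (b i)| <= mdist x x0 + 4 * r /\
    ((exists2 a, a \in s & mdist x a < 2 * r) ->
      `|f x - \sum_(i < n) phi i x * f (b i)| <= 4 * r).
Proof.
move=> r0; have r4 : 0 <= 4 * r by rewrite mulr_ge0// ltW.
elim: s => [|a s [n [phi [b [bphi IH]]]]].
  exists 1%N, (fun=> cst 1), (fun=> x0); split; first by move=> _; exact: blip_cst.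
  move=> f /shortP sf x; rewrite big_ord1 mul1r; split; last by case.
  by have := klip_norm x x0 sf; rewrite mul1r => /le_trans; apply; rewrite lerDl.
(* [beta] vanishes on the ball [B] and is [1] beyond distance [2 * r] from it, so [1 - beta] lives
   within [4 * r] of [a]; hence the constant [4 * r]. *)
pose B := [set x | mdist x a < 2 * r]; pose beta := bump B (2 * r)^-1.
have r2 : 0 < 2 * r by rewrite mulr_gt0.
have r2V : 0 <= (2 * r)^-1 by rewrite invr_ge0 ltW.
have bbeta : blip beta by exact: bump_blip.
pose th x := 1 - beta x.
have bth : blip th by apply: blipB => //; exact: blip_cst.
exists n.+1, (fun i x => if i is j.+1 then beta x * phi j x else th x),
  (fun i => if i is j.+1 then b j else a); split.
  by case=> [//|i]; exact: blipM.
move=> f sf x; rewrite big_ord_recl/=.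
set S := \sum_(i < n) phi i x * f (b i).
have -> : \sum_(i < n) beta x * phi i x * f (b i) = beta x * S.
  by rewrite mulr_sumr; apply: eq_bigr => i _; rewrite mulrA.
have b0 : 0 <= beta x by exact: bump_ge0.
have b1 : beta x <= 1 by exact: bump_le1.
have th0 : 0 <= th x by rewrite subr_ge0.
(* As [th] and [beta] sum to [1], the new error is a convex combination of the error at [a] and the
   previous error. *)
have -> : f x - (th x * f a + beta x * S) = th x * (f x - f a) + beta x * (f x - S).
  by rewrite /th; lra.
have thE : th x * `|f x - f a| <= th x * (4 * r).
  have [bx1|bx1] := ltP (beta x) 1; last first.
    by rewrite /th (_ : beta x = 1) ?subrr ?mul0r//; lra.
  rewrite ler_wpM2l//; have [y /= ya xy] := bump_lt bx1 (lexx 1).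
  move/shortP : sf => /(klip_norm x a); rewrite mul1r => /le_trans; apply.
  move: xy; rewrite mulrC ltr_pdivrMr// mul1r => xy.
  have ya' : mdist y a < 2 * r by [].
  by have := metric_triangle x y a; lra.
have normE : `|th x * (f x - f a) + beta x * (f x - S)| <=
    th x * (4 * r) + beta x * `|f x - S|.
  rewrite (le_trans (ler_normD _ _))// !normrM (ger0_norm th0) (ger0_norm b0).
  by rewrite lerD2r.
have [IH1 IH2] := IH f sf x; split.
  rewrite (le_trans normE)//; have := ler_wpM2l b0 IH1.
  have := mdist_ge0 x x0; rewrite /th => d0; rewrite mulrDr => H.
  have : beta x * mdist x x0 <= mdist x x0 by rewrite ler_piMl.
  by lra.
move=> [c]; rewrite inE => /predU1P[->|cs] xc.
  have bx0 : beta x = 0 by rewrite /beta bump_in.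
  by rewrite (le_trans normE)// /th bx0; lra.
have := IH2 (ex_intro2 _ _ c cs xc) => /(ler_wpM2l b0) H.
by rewrite (le_trans normE)//; move: H; rewrite /th; lra.
Qed.

(** The weights are the integrals of a partition of unity around a net of a tight compact set, hence
    independent of [f]. Near the compact set the error is at most [4 * r]; elsewhere it grows at
    most like the distance to [x0], whose integral there is small by the first moment. *)
Lemma radon_finite_approx (p : radon X) (e : R) : 0 < e ->
  exists n (c : nat -> R) (b : nat -> X), forall f, short (f : X -> R^o) ->
    `|expectation p f - \sum_(i < n) c i * f (b i)| <= e.
Proof.
move=> e0; have [x0] := radon_inhabited p; have mp := expectation_mean p.
pose D x := mdist x x0; have lD : lip D by exact: lip_mdist.
have D0 x : 0 <= D x by exact: mdist_ge0.
have e4 : 0 < e / 4 by rewrite divr_gt0.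
have /cvgrPdist_le/(_ _ e4)[N _ /(_ N (leqnn N))/=] :=
  @ge0_lip_expectation_cvg _ _ p D lD D0.
rewrite ler_norml => /andP[_ DN].
have lDN : lip (fun x => Num.min (D x) N%:R) by apply: lip_min => //; exact: lip_cst.
have N1 : 0 < (N%:R + 1 : R) by rewrite ltr_wpDl.
have [K cK pK] := radon_tight p (divr_gt0 e4 N1).
pose r := e / 8; have r0 : 0 < r by rewrite divr_gt0.
have rV : 0 <= r^-1 by rewrite invr_ge0 ltW.
have [s sP] := compact_net cK r0.
have [n [phi [b [bphi phiP]]]] := lip_partition x0 s r0.
exists n, (fun i => expectation p (phi i)), b => f sf.
have lf := short_lip sf.
have lb : lip (bump K r^-1) by exact: blip_lip (bump_blip _ _).
have lNb : lip (fun x => N%:R * bump K r^-1 x) by exact: lipZ.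
have lS i : lip (fun x => phi i x * f (b i)).
  by apply: blip_lip; apply: blipM => //; exact: blip_cst.
have -> : \sum_(i < n) expectation p (phi i) * f (b i) =
    expectation p (fun x => \sum_(i < n) phi i x * f (b i)).
  rewrite (mean_sum mp)//; apply: eq_bigr => i _.
  rewrite mulrC -(meanZ mp); last exact: blip_lip.
  by congr expectation; apply/funext => x; rewrite mulrC.
(* The three terms integrate to at most [e / 2], [e / 4] and [e / 4]: the net, the tail of the
   distance above [N], and the truncated distance away from [K]. *)
pose h x := 4 * r + ((D x - Num.min (D x) N%:R) + N%:R * bump K r^-1 x).
have lDD : lip (fun x => D x - Num.min (D x) N%:R) by exact: lipB.
have lDDN : lip (fun x => (D x - Num.min (D x) N%:R) + N%:R * bump K r^-1 x).
  exact: lipD.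
have lh : lip h by apply: lipD => //; exact: lip_cst.
apply: (@le_trans _ _ (expectation p h)).
  apply: (mean_dist mp) => //; first exact: lip_sum.
  move=> x; have [fx1 fx2] := phiP f sf x; rewrite /h.
  have DD : 0 <= D x - Num.min (D x) N%:R by rewrite subr_ge0 ge_min lexx.
  have [bx|bx] := ltP (bump K r^-1 x) 1.
    have [y Ky xy] := bump_lt bx (lexx 1).
    have [a sa [_ ya]] := sP _ Ky.
    apply: (@le_trans _ _ (4 * r)).
      apply: fx2; exists a => //; move: xy; rewrite mulrC ltr_pdivrMr// mul1r => xy.
      by have := metric_triangle x y a; lra.
    by rewrite lerDl addr_ge0// mulr_ge0// bump_ge0.
  have -> : bump K r^-1 x = 1 by apply/eqP; rewrite eq_le bx bump_le1.
  have : Num.min (D x) N%:R <= N%:R by rewrite ge_min lexx orbT.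
  by move: fx1; rewrite -/(D x); lra.
rewrite (meanD mp (lip_cst X (4 * r)) lDDN) (mean_cst mp) (meanD mp lDD lNb).
rewrite (meanB mp lD lDN) (meanZ mp N%:R lb).
have : N%:R * expectation p (bump K r^-1) <= e / 4.
  have := pK _ rV; rewrite ler_pdivlMr// => pKr.
  rewrite mulrC (le_trans _ pKr)// ler_wpM2l ?lerDl//.
  by apply: (mean_ge0 mp) => // x; exact: bump_ge0.
by rewrite /r; lra.
Qed.

End finite_approximation.

(** One finite approximation of [p] serves both the averaged function of [x] and all slices at fixed
    [y]; for finite sums, the exchange is linearity of the integral against [q]. *)
Lemma expectation_exchange (R : realType) (X Y : metricType R) (p : radon X)
    (q : radon Y) (f : X -> Y -> R) :
  (forall x, short (f x : Y -> R^o)) -> (forall y, short (f^~ y : X -> R^o)) ->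
  expectation p (fun x => expectation q (f x)) =
  expectation q (fun y => expectation p (f^~ y)).
Proof.
move=> sx sy; have mp := expectation_mean p; have mq := expectation_mean q.
have lx x := short_lip (sx x); have ly y := short_lip (sy y).
have sp : short ((fun y => expectation p (f^~ y)) : Y -> R^o).
  apply/shortP; apply: (@mean_klip _ _ _ _ (fun y x => f x y)) => //.
  by move=> x; exact/shortP.
have sq : short ((fun x => expectation q (f x)) : X -> R^o).
  by apply/shortP; apply: mean_klip => // y; exact/shortP.
apply/eqP; rewrite -subr_eq0 -normr_le0; apply/ler_addgt0Pl => e e0.
rewrite addr0; have e2 : 0 < e / 2 by rewrite divr_gt0.
have [n [c [b cb]]] := radon_finite_approx p e2.
have lc i : lip (fun y => c i * f (b i) y) by exact: lipZ.
have H1 := cb _ sq.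
have H2 : `|expectation q (fun y => expectation p (f^~ y)) -
    \sum_(i < n) c i * expectation q (f (b i))| <= e / 2.
  have -> : \sum_(i < n) c i * expectation q (f (b i)) =
      expectation q (fun y => \sum_(i < n) c i * f (b i) y).
    by rewrite (mean_sum mq)//; apply: eq_bigr => i _; rewrite (meanZ mq).
  rewrite -[leRHS](mean_cst mq); apply: (mean_dist mq).
  - exact: short_lip.
  - exact: lip_sum.
  - exact: lip_cst.
  - by move=> y; exact: cb.
move: H1 H2; rewrite !ler_norml => /andP[a1 a2] /andP[b1 b2].
by apply/andP; split; lra.
Qed.

(** For tightness, [mu] is concentrated near a compact set of measures, which has a finite net; the
    union of tight compact sets for the net points is then almost full for every measure nearby.
    Continuity along truncations is dominated convergence for [p], then for [mu]. *)
Lemma radon_barycenter (R : realType) (X : cmet R)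
    (mu : radon (cmet_of (@kdist_is_complete_metric R X))) :
  exists q : radon X, forall f, short (f : X -> R^o) ->
    expectation q f = expectation mu (fun p : radon X => expectation p f).
Proof.
set PX := cmet_of _ in mu *; have mmu := expectation_mean mu.
have klipE f c : 0 < c -> klip c f -> klip c (fun p : PX => expectation (p : radon X) f).
  move=> c0 fc p q; rewrite (le_trans (ler_norm _))//.
  exact: (expectation_klip (p : radon X) (q : radon X)).
have lipE f : lip f -> lip (fun p : PX => expectation (p : radon X) f).
  by move=> /lip_gt0[c c0 fc]; exists c; [exact: ltW|exact: klipE].
apply: daniell_radon.
- split.
  + move=> a f g lf lg; rewrite -(mean_lin mmu); [|exact: lipE..].
    by congr expectation; apply/funext => p; rewrite (mean_lin (expectation_mean _)).
  + move=> f lf f0; apply: (mean_ge0 mmu); first exact: lipE.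
    by move=> p; exact: (mean_ge0 (expectation_mean _) lf).
  + rewrite (_ : (fun _ => _) = cst 1) ?expectation_cst//.
    by apply/funext => p; rewrite expectation_cst.
- move=> e r e0 r0; have e3 : 0 < e / 3 by rewrite divr_gt0.
  have [K cK muK] := radon_tight mu e3.
  (* Measures at distance at most [2 * d] give the bump of slope [r] integrals differing by at most
     [(r + 1) * (2 * d) = e / 3]. *)
  pose d := e / (6 * (r + 1)); have r1 : 0 < r + 1 by rewrite ltr_wpDl.
  have d0 : 0 < d by rewrite divr_gt0// mulr_gt0.
  have dV : 0 <= d^-1 by rewrite invr_ge0 ltW.
  have [s sP] := compact_net cK d0.
  have /choice[C CP] (p : PX) : exists C : set X, compact C /\
      forall r, 0 <= r -> expectation (p : radon X) (bump C r) <= e / 3.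
    by have [C cC pC] := radon_tight (p : radon X) e3; exists C.
  exists (\big[setU/set0]_(p <- s) C p).
    by apply: bigsetU_compact => p _; exact: (CP p).1.
  set L := \big[_/_]_(p <- s) C p.
  have lL : lip (bump L r) by exact: blip_lip (bump_blip _ _).
  have kL : klip (r + 1) (bump L r) by apply: klip_le (bump_klip _ r0); rewrite lerDl.
  have lK : lip (bump K d^-1) by exact: blip_lip (bump_blip _ _).
  pose k : R := 2 * (e / 3).
  have l1 : lip (fun p : PX => k + bump K d^-1 p).
    by apply: lipD => //; exact: lip_cst.
  apply: (@le_trans _ _ (expectation mu (fun p => k + bump K d^-1 p))).
    apply: (le_mean mmu) => //; first exact: lipE.
    move=> p; have [bp|bp] := ltP (bump K d^-1 p) 1; last first.
      apply: (@le_trans _ _ 1); last by rewrite /k; lra.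
      rewrite -[leRHS](expectation_cst (p : radon X)).
      apply: (le_mean (expectation_mean _)) => //; first exact: lip_cst.
      by move=> x; exact: bump_le1.
    have [q Kq] := bump_lt bp (lexx 1); rewrite mulrC ltr_pdivrMr// mul1r => pq.
    have [u su [_ qu]] := sP _ Kq.
    have pu : kdist (p : radon X) (u : radon X) <= 2 * d.
      have pqu : kdist (p : radon X) u <= kdist (p : radon X) q + kdist (q : radon X) u.
        exact: (metric_triangle p q u).
      have pq' : kdist (p : radon X) q < d by [].
      have qu' : kdist (q : radon X) u < d by [].
      lra.
    have uL : expectation (u : radon X) (bump L r) <= e / 3.
      rewrite (le_trans _ ((CP u).2 _ r0))//.
      apply: (le_mean (expectation_mean _)) => //.
        exact: blip_lip (bump_blip _ _).
      by move=> x; apply: bump_subset => //; rewrite /L -bigcup_seq; exact: bigcup_sup.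
    have := expectation_klip (p : radon X) (u : radon X) r1 kL.
    rewrite ler_norml => /andP[_ puL].
    have : (r + 1) * kdist (p : radon X) (u : radon X) <= e / 3.
      rewrite (le_trans (ler_wpM2l (ltW r1) pu))// /d.
      by rewrite [leLHS](_ : _ = e / 3)//; field; rewrite gt_eqF.
    by have := bump_ge0 K dV p; rewrite /k; lra.
  rewrite (meanD mmu (lip_cst PX k) lK) (mean_cst mmu).
  by have := muK _ dV; rewrite /k; lra.
- move=> f sf f0; have lf := short_lip sf.
  have lm n : lip (fun x => Num.min (f x) n%:R) by apply: lip_min => //; exact: lip_cst.
  apply: (expectation_dominated_cvg (g := fun p : PX => expectation (p : radon X) f)).
  + by move=> n; exact: lipE.
  + exact: lipE.
  + exact: lipE.
  + move=> n p; rewrite ger0_norm.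
      apply: (le_mean (expectation_mean _)) => // x.
      by rewrite ge_min lexx.
    by apply: (mean_ge0 (expectation_mean _)) => // x; rewrite le_min f0 ler0n.
  + by move=> p; exact: (@ge0_lip_expectation_cvg _ _ (p : radon X)).
Qed.
(** * The structure maps and their equations *)

Section short_lemmas.
Variables (R : realType) (X Y : cmet R).

Lemma short_norm (f : X -> R) x y : short (f : X -> R^o) ->
  `|f x - f y| <= mdist x y.
Proof. by move=> /shortP/(klip_norm x y); rewrite mul1r. Qed.

Lemma slice_left_short (y : Y) : short (fun x : X => (x, y) : tensor X Y).
Proof. by move=> x x'; rewrite tensor_distE/= mdistxx addr0. Qed.

Definition slice_left (y : Y) : short_map X (tensor X Y) :=
  ShortMap (slice_left_short y).

Lemma slice_right_short (x : X) : short (fun y : Y => (x, y) : tensor X Y).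
Proof. by move=> y y'; rewrite tensor_distE/= mdistxx add0r. Qed.

Definition slice_right (x : X) : short_map Y (tensor X Y) :=
  ShortMap (slice_right_short x).

Lemma tensor_fst_short : short (fun a : tensor X Y => (a : X * Y).1).
Proof. by move=> a b; rewrite tensor_distE lerDl mdist_ge0. Qed.

Definition tensor_fst : short_map (tensor X Y) X := ShortMap tensor_fst_short.

Lemma tensor_snd_short : short (fun a : tensor X Y => (a : X * Y).2).
Proof. by move=> a b; rewrite tensor_distE lerDr mdist_ge0. Qed.

Definition tensor_snd : short_map (tensor X Y) Y := ShortMap tensor_snd_short.

End short_lemmas.

(** * Push-forward, Dirac, barycenter, product and marginal maps *)

Section kantorovich_structure.
Variable R : realType.
Implicit Types X Y Z : cmet R.

Notation K := (@kdist_is_complete_metric R).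
Notation P := (kantorovich K).

Lemma expectation_short X (f : X -> R) : short (f : X -> R^o) ->
  short ((fun p : P X => expectation (p : radon X) f) : P X -> R^o).
Proof.
move=> sf; apply/shortP => p q; rewrite mul1r (le_trans (ler_norm _))//.
exact: (expectation_kdist (p : radon X) q sf).
Qed.

(** The distance of [P X] is a supremum over integrals, so shortness can be tested one integral at a
    time. *)
Lemma kantorovich_short X (T : metricType R) (F : T -> P X) :
  (forall f, short (f : X -> R^o) ->
    short ((fun t => expectation (F t : radon X) f) : T -> R^o)) -> short F.
Proof.
move=> sF t t'; apply: kdist_le => f /sF/shortP/(klip_norm t t').
by rewrite mul1r.
Qed.

Definition kimage X Y (f : short_map X Y) (p : P X) : P Y :=
  sval (cid (radon_image f (p : radon X))).

Lemma kimageE X Y (f : short_map X Y) (p : P X) B : <<s open >> B ->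
  radon_prob (kimage f p : radon Y) B = radon_prob (p : radon X) (f @^-1` B).
Proof. by rewrite /kimage; case: cid => q /= [qE _]; exact: qE. Qed.

Lemma expectation_kimage X Y (f : short_map X Y) (p : P X) (g : Y -> R) :
  short (g : Y -> R^o) ->
  expectation (kimage f p : radon Y) g = expectation (p : radon X) (fun x => g (f x)).
Proof.
by move=> /short_lip lg; rewrite /kimage; case: cid => q /= [_]; exact.
Qed.

Lemma kimage_short X Y (f : short_map X Y) : short (kimage f).
Proof.
apply: kantorovich_short => g sg; under eq_fun do rewrite expectation_kimage//.
by apply: expectation_short; exact: short_fun_short.
Qed.

Definition kmap X Y (f : short_map X Y) : short_map (P X) (P Y) :=
  ShortMap (kimage_short f).

Definition kdirac_fun X (x : X) : P X := sval (cid (radon_dirac x)).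

Lemma kdirac_funE X (x : X) A : <<s open >> A ->
  radon_prob (kdirac_fun x : radon X) A = (\1_A x)%:E.
Proof. by rewrite /kdirac_fun; case: cid => q /= [qE _]; exact: qE. Qed.

Lemma expectation_kdirac X (x : X) (g : X -> R) : short (g : X -> R^o) ->
  expectation (kdirac_fun x : radon X) g = g x.
Proof.
by move=> /short_lip lg; rewrite /kdirac_fun; case: cid => q /= [_]; exact.
Qed.

Lemma kdirac_short X : short (@kdirac_fun X).
Proof.
by apply: kantorovich_short => g sg; under eq_fun do rewrite expectation_kdirac//.
Qed.

Definition kdirac X : short_map X (P X) := ShortMap (@kdirac_short X).

Definition kbary_fun X (mu : P (P X)) : P X :=
  sval (cid (radon_barycenter (mu : radon (P X)))).

Lemma expectation_kbary X (mu : P (P X)) (g : X -> R) : short (g : X -> R^o) ->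
  expectation (kbary_fun mu : radon X) g =
  expectation (mu : radon (P X)) (fun p : P X => expectation (p : radon X) g).
Proof. by move=> sg; rewrite /kbary_fun; case: cid => q /=; exact. Qed.

Lemma kbary_short X : short (@kbary_fun X).
Proof.
apply: kantorovich_short => g sg; under eq_fun do rewrite expectation_kbary//.
by do 2 apply: expectation_short.
Qed.

Definition kbary X : short_map (P (P X)) (P X) := ShortMap (@kbary_short X).

Section joint.
Variables X Y : cmet R.

Lemma kslice_short (p : P X) : short (fun y : Y => kimage (slice_left X y) p).
Proof.
apply: kantorovich_short => f sf; under eq_fun do rewrite expectation_kimage//.
apply/shortP; apply: (@mean_klip _ Y X _ (fun y x => f (x, y))).
- exact: expectation_mean.
- by move=> y; apply: short_lip; exact: (short_fun_short (slice_left X y) sf).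
- by move=> x; apply/shortP; exact: (short_fun_short (slice_right Y x) sf).
Qed.

Definition kslice (p : P X) : short_map Y (P (tensor X Y)) :=
  ShortMap (kslice_short p).

Definition kjoint_fun (a : tensor (P X) (P Y)) : P (tensor X Y) :=
  kbary_fun (kimage (kslice (a : P X * P Y).1) (a : P X * P Y).2).

Lemma expectation_partial_short (p : P X) (f : X * Y -> R) :
  short (f : tensor X Y -> R^o) ->
  short ((fun y => expectation (p : radon X) (fun x => f (x, y))) : Y -> R^o).
Proof.
move=> sf; have := short_fun_short (kslice p) (expectation_short sf).
by congr short; apply/funext => y; exact: expectation_kimage.
Qed.

Lemma expectation_kjoint (p : P X) (q : P Y) (f : X * Y -> R) :
  short (f : tensor X Y -> R^o) ->
  expectation (kjoint_fun (p, q) : radon (tensor X Y)) f =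
  expectation (q : radon Y) (fun y => expectation (p : radon X) (fun x => f (x, y))).
Proof.
move=> sf; rewrite expectation_kbary// expectation_kimage; last exact: expectation_short.
by congr expectation; apply/funext => y; exact: expectation_kimage.
Qed.

(** Changing [p] with [q] fixed and then [q] costs the two distances in turn, and their sum is the
    distance on the tensor product. *)
Lemma kjoint_short : short kjoint_fun.
Proof.
apply: kantorovich_short => f sf; apply/shortP => -[p q] [p' q'].
rewrite !expectation_kjoint// mul1r tensor_distE/=.
set g := fun p y => expectation (p : radon X) (fun x => f (x, y)).
have sg p0 : short (g p0 : Y -> R^o) by exact: expectation_partial_short.
have : `|expectation (q : radon Y) (g p) - expectation (q : radon Y) (g p')| <=
    kdist (p : radon X) (p' : radon X).
  rewrite -[leRHS](expectation_cst (q : radon Y)).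
  apply: (mean_dist (expectation_mean _)); [exact: short_lip..|exact: lip_cst|].
  move=> y; apply: expectation_kdist; exact: (short_fun_short (slice_left X y) sf).
have := expectation_kdist (q : radon Y) (q' : radon Y) (sg p').
rewrite !ler_norml => /andP[_ a] /andP[_ b].
rewrite -[mdist p p']/(kdist (p : radon X) (p' : radon X)).
rewrite -[mdist q q']/(kdist (q : radon Y) (q' : radon Y)).
by rewrite -/(g p) -/(g p'); lra.
Qed.

Definition kjoint : short_map (tensor (P X) (P Y)) (P (tensor X Y)) :=
  ShortMap kjoint_short.

Definition kmarg_fun (r : P (tensor X Y)) : tensor (P X) (P Y) :=
  (kimage (tensor_fst X Y) r, kimage (tensor_snd X Y) r).

(* The distance on the tensor product is a sum, but [s f(x) + t g(y)] is short
   on it for all signs [s] and [t]. *)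
Lemma kmarg_short : short kmarg_fun.
Proof.
(* Isolating one summand at a time, two uses of [kdist_le] reduce the sum of two suprema to a fixed
   pair [f], [g]. *)
move=> r r'; rewrite tensor_distE/= -lerBrDr; apply: kdist_le => f sf.
rewrite lerBrDl -lerBrDr; apply: kdist_le => g sg; rewrite lerBrDr.
rewrite !expectation_kimage//.
pose f' (a : tensor X Y) := f (tensor_fst X Y a).
pose g' (a : tensor X Y) := g (tensor_snd X Y a).
have lf : lip f' by apply/short_lip/short_fun_short.
have lg : lip g' by apply/short_lip/short_fun_short.
rewrite -/f' -/g'.
have H (s t : R) : `|s| = 1 -> `|t| = 1 ->
    s * (expectation (r : radon (tensor X Y)) f' -
         expectation (r' : radon (tensor X Y)) f') +
    t * (expectation (r : radon (tensor X Y)) g' -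
         expectation (r' : radon (tensor X Y)) g')
    <= kdist (r : radon (tensor X Y)) (r' : radon (tensor X Y)).
  move=> s1 t1.
  have sh : short ((fun a => s * f' a + t * g' a) : tensor X Y -> R^o).
    apply/shortP => a b; rewrite mul1r tensor_distE.
    rewrite opprD addrACA -!mulrBr (le_trans (ler_norm _))//.
    rewrite (le_trans (ler_normD _ _))// !normrM s1 t1 !mul1r.
    apply: lerD; first exact: (short_norm (a : X * Y).1 (b : X * Y).1 sf).
    exact: (short_norm (a : X * Y).2 (b : X * Y).2 sg).
  have := expectation_kdist (r : radon (tensor X Y)) (r' : radon (tensor X Y)) sh.
  rewrite !(mean_lin (expectation_mean _))//; try exact: lipZ.
  rewrite !(meanZ (expectation_mean _))//.
  by rewrite ler_norml => /andP[_]; lra.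
have n1 : `|- 1 : R| = 1 by rewrite normrN1.
have p1 : `|1 : R| = 1 by rewrite normr1.
have := H _ _ p1 p1; have := H _ _ n1 p1; have := H _ _ p1 n1; have := H _ _ n1 n1.
have -> : mdist r r' = kdist (r : radon (tensor X Y)) (r' : radon (tensor X Y)) by [].
set k := kdist _ _ => a b c d.
set u := expectation _ f' - expectation _ f' in a b c d *.
set v := expectation _ g' - expectation _ g' in a b c d *.
by case: (ger0P u) => u0; case: (ger0P v) => v0; lra.
Qed.

Definition kmarg : short_map (P (tensor X Y)) (tensor (P X) (P Y)) :=
  ShortMap kmarg_short.

End joint.

Definition keta : short_map (one_point R) (P (one_point R)) := kdirac (one_point R).

Lemma keps_short : short (fun _ : P (one_point R) => tt : one_point R).
Proof. by move=> p q; rewrite mdistxx mdist_ge0. Qed.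

Definition keps : short_map (P (one_point R)) (one_point R) := ShortMap keps_short.

(** * Equations between the structure maps *)

Lemma kext X (p q : P X) : (forall f, short (f : X -> R^o) ->
  expectation (p : radon X) f = expectation (q : radon X) f) -> p = q.
Proof. exact: radon_ext. Qed.

Lemma kimage_id X (p : P X) : kimage (short_id X) p = p.
Proof. by apply: kext => f sf; rewrite expectation_kimage. Qed.

Lemma kimage_comp X Y Z (g : short_map Y Z) (f : short_map X Y) (p : P X) :
  kimage (short_comp g f) p = kimage g (kimage f p).
Proof.
apply: kext => h sh; rewrite !expectation_kimage//.
exact: (short_fun_short g sh).
Qed.

(** Marginals are images under projections, so naturality of the marginals reduces to commuting
    squares of underlying maps. *)
Lemma kimage_comm X Y Y' Z (g : short_map Y Z) (f : short_map X Y)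
    (g' : short_map Y' Z) (f' : short_map X Y') (p : P X) :
  (forall x, g (f x) = g' (f' x)) -> kimage g (kimage f p) = kimage g' (kimage f' p).
Proof.
by move=> gf; rewrite -!kimage_comp; congr kimage; exact: short_map_eq.
Qed.

Lemma kimage_kdirac X Y (f : short_map X Y) (x : X) :
  kimage f (kdirac X x) = kdirac Y (f x).
Proof.
apply: kext => h sh; rewrite expectation_kimage// !expectation_kdirac//.
exact: (short_fun_short f sh).
Qed.

Lemma kimage_kbary X Y (f : short_map X Y) (mu : P (P X)) :
  kimage f (kbary X mu) = kbary Y (kimage (kmap f) mu).
Proof.
apply: kext => h sh; have shf := short_fun_short f sh.
rewrite expectation_kimage// !expectation_kbary// expectation_kimage; last first.
  exact: expectation_short.
by congr expectation; apply/funext => p; rewrite expectation_kimage.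
Qed.

Lemma kbary_kdirac X (p : P X) : kbary X (kdirac (P X) p) = p.
Proof.
apply: kext => f sf; rewrite expectation_kbary// expectation_kdirac//.
exact: expectation_short.
Qed.

Lemma kbary_kimage_kdirac X (p : P X) : kbary X (kimage (kdirac X) p) = p.
Proof.
apply: kext => f sf; rewrite expectation_kbary// expectation_kimage; last first.
  exact: expectation_short.
by congr expectation; apply/funext => x; rewrite expectation_kdirac.
Qed.

Lemma kbary_assoc X (nu : P (P (P X))) :
  kbary X (kbary (P X) nu) = kbary X (kimage (kbary X) nu).
Proof.
apply: kext => f sf; have se := expectation_short sf.
rewrite !expectation_kbary// expectation_kimage//.
by congr expectation; apply/funext => mu; rewrite expectation_kbary.
Qed.

Lemma kjoint_natural X X' Y Y' (f : short_map X X') (g : short_map Y Y')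
    (p : P X) (q : P Y) :
  kjoint X' Y' (kimage f p, kimage g q) = kimage (tensor_map f g) (kjoint X Y (p, q)).
Proof.
apply: kext => h sh; have shf := short_fun_short (tensor_map f g) sh.
rewrite expectation_kimage// !expectation_kjoint// expectation_kimage; last first.
  exact: expectation_partial_short.
congr expectation; apply/funext => y; rewrite expectation_kimage//.
exact: (short_fun_short (slice_left X' (g y)) sh).
Qed.

Lemma kjoint_assoc X Y Z (p : P X) (q : P Y) (r : P Z) :
  kimage (tensor_assoc X Y Z) (kjoint (tensor X Y) Z (kjoint X Y (p, q), r)) =
  kjoint X (tensor Y Z) (p, kjoint Y Z (q, r)).
Proof.
apply: kext => h sh; have sha := short_fun_short (tensor_assoc X Y Z) sh.
rewrite expectation_kimage// !expectation_kjoint//; last first.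
  exact: expectation_partial_short.
congr expectation; apply/funext => z; rewrite expectation_kjoint//.
exact: (short_fun_short (slice_left (tensor X Y) z) sha).
Qed.

Lemma kjoint_lunit X (p : P X) :
  kimage (tensor_lunit X) (kjoint (one_point R) X (kdirac (one_point R) tt, p)) = p.
Proof.
apply: kext => h sh; have shl := short_fun_short (tensor_lunit X) sh.
rewrite expectation_kimage// expectation_kjoint//.
by congr expectation; apply/funext => x /=; rewrite (expectation_cst _ (h x)).
Qed.

Lemma kjoint_runit X (p : P X) :
  kimage (tensor_runit X) (kjoint X (one_point R) (p, kdirac (one_point R) tt)) = p.
Proof.
apply: kext => h sh; have shl := short_fun_short (tensor_runit X) sh.
rewrite expectation_kimage// expectation_kjoint//.
exact: (expectation_cst _ (expectation (p : radon X) h)).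
Qed.

(** The product integrates its first variable innermost, so symmetry is an exchange of integrals. *)
Lemma kjoint_braid X Y (p : P X) (q : P Y) :
  kimage (tensor_braid X Y) (kjoint X Y (p, q)) = kjoint Y X (q, p).
Proof.
apply: kext => h sh; have shb := short_fun_short (tensor_braid X Y) sh.
rewrite expectation_kimage// !expectation_kjoint//=.
apply: (expectation_exchange (q : radon Y) (p : radon X) (f := fun y x => h (y, x))).
  by move=> y; exact: (short_fun_short (slice_right X y) sh).
by move=> x; exact: (short_fun_short (slice_left Y x) sh).
Qed.

Lemma kjoint_kdirac X Y (x : X) (y : Y) :
  kjoint X Y (kdirac X x, kdirac Y y) = kdirac (tensor X Y) (x, y).
Proof.
apply: kext => h sh; rewrite expectation_kjoint// !expectation_kdirac//.
  exact: (short_fun_short (slice_left X y) sh).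
exact: expectation_partial_short.
Qed.

(** From the outside in, the left side integrates over [nu], [mu], [q], [p] and the right side over
    [nu], [q], [mu], [p]; only [mu] and [q] have to be exchanged. *)
Lemma kjoint_kbary X Y (mu : P (P X)) (nu : P (P Y)) :
  kbary (tensor X Y) (kimage (kjoint X Y) (kjoint (P X) (P Y) (mu, nu))) =
  kjoint X Y (kbary X mu, kbary Y nu).
Proof.
apply: kext => h sh; have se := expectation_short sh.
have sje := short_fun_short (kjoint X Y) se.
rewrite expectation_kbary// expectation_kimage// !expectation_kjoint//.
rewrite expectation_kbary; last exact: expectation_partial_short.
congr expectation; apply/funext => q.
have sl y : short ((fun x => h (x, y)) : X -> R^o).
  exact: (short_fun_short (slice_left X y) sh).
under [in RHS]eq_fun do rewrite expectation_kbary//.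
rewrite -(@expectation_exchange R (P X) Y mu q
  (fun p y => expectation (p : radon X) (fun x => h (x, y)))).
- by congr expectation; apply/funext => p; rewrite expectation_kjoint.
- by move=> p; exact: expectation_partial_short.
- by move=> y; exact: expectation_short.
Qed.

(* Stated for arbitrary maps [i] and [j] that exchange the two inner factors
   because conversion blows up once [interchange] may be unfolded. *)
Lemma kmarg_kjoint W X Y Z
    (i : short_map (tensor (tensor W X) (tensor Y Z))
                   (tensor (tensor W Y) (tensor X Z)))
    (j : short_map (tensor (tensor (P W) (P X)) (tensor (P Y) (P Z)))
                   (tensor (tensor (P W) (P Y)) (tensor (P X) (P Z)))) :
  (forall w x y z, i ((w, x), (y, z)) = ((w, y), (x, z))) ->
  (forall p q r s, j ((p, q), (r, s)) = ((p, r), (q, s))) ->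
  short_comp (short_comp (kmarg (tensor W Y) (tensor X Z)) (kmap i))
    (kjoint (tensor W X) (tensor Y Z)) =
  short_comp (short_comp (tensor_map (kjoint W Y) (kjoint X Z)) j)
    (tensor_map (kmarg W X) (kmarg Y Z)).
Proof.
move=> iE jE; apply: short_map_eq => -[r s].
pose rs := kjoint (tensor W X) (tensor Y Z) (r, s).
(* By naturality a product of marginals is an image of [rs], so each component compares two maps on
   the underlying spaces. *)
have fstE : kimage (tensor_fst (tensor W Y) (tensor X Z)) (kimage i rs) =
    kjoint W Y (kimage (tensor_fst W X) r, kimage (tensor_fst Y Z) s).
  rewrite kjoint_natural -kimage_comp; congr kimage.
  by apply: short_map_eq => -[[w x] [y z]] /=; rewrite iE.
have sndE : kimage (tensor_snd (tensor W Y) (tensor X Z)) (kimage i rs) =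
    kjoint X Z (kimage (tensor_snd W X) r, kimage (tensor_snd Y Z) s).
  rewrite kjoint_natural -kimage_comp; congr kimage.
  by apply: short_map_eq => -[[w x] [y z]] /=; rewrite iE.
by rewrite /= /kmarg_fun jE/=; exact: (f_equal2 pair fstE sndE).
Qed.

Lemma one_point_kdirac (p : P (one_point R)) : p = kdirac (one_point R) tt.
Proof.
apply: kext => f sf; rewrite expectation_kdirac//.
rewrite (_ : f = cst (f tt)) ?expectation_cst//.
by apply/funext => -[].
Qed.

End kantorovich_structure.

(** * The symmetric bimonoidal monad on complete metric spaces *)

Section kantorovich_monad.
Variable R : realType.

Definition kendo : endomap (CMet R) :=
  @Endomap (CMet R) (kantorovich (@kdist_is_complete_metric R)) (@kmap R).
Definition kunit : transformation (endo_id (CMet R)) kendo := @kdirac R.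
Definition kmult : transformation (endo_comp kendo kendo) kendo := @kbary R.
Definition klax : lax kendo := @Lax (CMet R) kendo (keta R) (@kjoint R).
Definition koplax : oplax kendo := @Oplax (CMet R) kendo (keps R) (@kmarg R).

(** With the opposite composite, this makes unit and counit mutually inverse: the Dirac measure is
    the only element of [P(1)]. *)
Lemma kunit_counit : compc (lax_unit klax) (oplax_unit koplax) = idc (kendo tunit).
Proof. by apply: short_map_eq => p; exact/esym/one_point_kdirac. Qed.

Lemma kendo_is_monad : is_monad kunit kmult.
Proof.
split.
- split=> [X|X Y Z g f]; apply: short_map_eq => p; first exact: kimage_id.
  exact: kimage_comp.
- by move=> X Y f; apply: short_map_eq => x; exact/esym/kimage_kdirac.
- by move=> X Y f; apply: short_map_eq => mu; exact/esym/kimage_kbary.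
- by move=> X; apply: short_map_eq => p; exact: kbary_kdirac.
- by move=> X; apply: short_map_eq => p; exact: kbary_kimage_kdirac.
- by move=> X; apply: short_map_eq => nu; exact: kbary_assoc.
Qed.

Lemma klax_is_lax_monoidal : is_lax_monoidal klax.
Proof.
split.
- by move=> X X' Y Y' f g; apply: short_map_eq => -[p q]; exact: kjoint_natural.
- by move=> X Y Z; apply: short_map_eq => -[[p q] r]; exact: kjoint_assoc.
- by move=> X; apply: short_map_eq => -[[] p]; exact: kjoint_lunit.
- by move=> X; apply: short_map_eq => -[p []]; exact: kjoint_runit.
Qed.

Lemma koplax_is_oplax_monoidal : is_oplax_monoidal koplax.
Proof.
split.
- move=> X X' Y Y' f g; apply: short_map_eq => r.
  by congr pair; exact: kimage_comm.
- move=> X Y Z; apply: short_map_eq => r.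
  by congr pair; [|congr pair]; rewrite /= -!kimage_comp; congr kimage;
    apply: short_map_eq => -[[]].
- by move=> X; apply: short_map_eq => r; congr kimage; exact: short_map_eq.
- by move=> X; apply: short_map_eq => r; congr kimage; exact: short_map_eq.
Qed.

Lemma klax_symmetric X Y : fmap kendo (braid X Y) \;c lax_mult klax X Y
  = lax_mult klax Y X \;c braid (kendo X) (kendo Y).
Proof. by apply: short_map_eq => -[p q]; exact: kjoint_braid. Qed.

Lemma koplax_symmetric X Y : oplax_mult koplax Y X \;c fmap kendo (braid X Y)
  = braid (kendo X) (kendo Y) \;c oplax_mult koplax X Y.
Proof.
apply: short_map_eq => r.
by congr pair; rewrite -kimage_comp; congr kimage; exact: short_map_eq.
Qed.

Lemma kunit_comult :
  oplax_mult koplax tunit tunit \;c fmap kendo (luniti tunit) \;c lax_unit klax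
  = (lax_unit klax *h lax_unit klax) \;c luniti tunit.
Proof. by apply: short_map_eq => -[]; congr pair; exact: one_point_kdirac. Qed.

Lemma kmult_counit :
  oplax_unit koplax \;c fmap kendo (lunit tunit) \;c lax_mult klax tunit tunit
  = lunit tunit \;c (oplax_unit koplax *h oplax_unit koplax).
Proof. exact: short_map_eq. Qed.

Lemma kunit_lax : is_lax_transformation (lax_id (CMet R)) klax kunit.
Proof.
split; first exact: short_map_eq.
by move=> X Y; apply: short_map_eq => -[x y]; exact/esym/kjoint_kdirac.
Qed.

Lemma kunit_oplax : is_oplax_transformation (oplax_id (CMet R)) koplax kunit.
Proof.
split; first by apply: short_map_eq => -[].
by move=> X Y; apply: short_map_eq => a; congr pair; exact: kimage_kdirac.
Qed.

Lemma kmult_oplax :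
  is_oplax_transformation (oplax_comp koplax koplax) koplax kmult.
Proof.
split; first exact: short_map_eq.
move=> X Y; apply: short_map_eq => mu; congr pair.
  rewrite /= kimage_kbary -kimage_comp.
  by congr kbary_fun; congr kimage; exact: short_map_eq.
rewrite /= kimage_kbary -kimage_comp.
by congr kbary_fun; congr kimage; exact: short_map_eq.
Qed.

Lemma kmult_lax : is_lax_transformation (lax_comp klax klax) klax kmult.
Proof.
split; first by apply: short_map_eq => -[]; exact: one_point_kdirac.
move=> X Y; apply: short_map_eq => -[mu nu]; rewrite /=; exact: kjoint_kbary.
Qed.

Lemma kbimonoidality (W X Y Z : CMet R) :
  oplax_mult koplax (W *t Y) (X *t Z) \;c fmap kendo (interchange W X Y Z)
    \;c lax_mult klax (W *t X) (Y *t Z)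
  = (lax_mult klax W Y *h lax_mult klax X Z)
    \;c interchange (kendo W) (kendo X) (kendo Y) (kendo Z)
    \;c (oplax_mult koplax W X *h oplax_mult koplax Y Z).
Proof.
by have := @kmarg_kjoint R W X Y Z (interchange W X Y Z)
  (interchange (kendo W) (kendo X) (kendo Y) (kendo Z)); apply.
Qed.

End kantorovich_monad.

Theorem theorem5p15 (R : realType) :
  exists (K : forall X : cmet R, is_complete_metric (@kdist R X))
    (Pmap : forall X Y : cmet R,
       short_map X Y -> short_map (kantorovich K X) (kantorovich K Y)),
  let P := @Endomap (CMet R) (kantorovich K) Pmap in
  exists (delta : transformation (endo_id (CMet R)) P)
    (E : transformation (endo_comp P P) P)
    (nabla : lax P) (Delta : oplax P),
    [/\ is_pushforward Pmap, is_dirac delta & is_barycenter E] /\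
    [/\ is_product_joint (lax_mult nabla),
        is_marginals (oplax_mult Delta) &
        compc (lax_unit nabla) (oplax_unit Delta) = idc (P tunit)] /\
    is_symmetric_bimonoidal_monad delta E nabla Delta.
Proof.
exists (@kdist_is_complete_metric R), (@kmap R) => P.
exists (@kunit R), (@kmult R), (klax R), (koplax R); split; [|split].
- split.
  + by move=> X Y f p B mB; exact: kimageE.
  + by move=> X x A mA; exact: kdirac_funE.
  + by move=> X mu f sf; exact: expectation_kbary.
- split; last exact: kunit_counit.
  + by move=> X Y p q f sf; exact: expectation_kjoint.
  + by move=> X Y r; split=> f sf; exact: expectation_kimage.
- split.
  + exact: kendo_is_monad.
  + exact: klax_is_lax_monoidal.
  + exact: koplax_is_oplax_monoidal.
  + exact: klax_symmetric.
  + exact: koplax_symmetric.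
  + exact: kbimonoidality.
  + by apply: short_map_eq => -[].
  + exact: kunit_comult.
  + exact: kmult_counit.
  + exact: kunit_lax.
  + exact: kunit_oplax.
  + exact: kmult_lax.
  + exact: kmult_oplax.
Qed.
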